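(* Let $d\ge 1$, let $\mathbb{B}^d=\{x\in\mathbb{R}^d: 1-\|x\|^2\ge 0\}$ be the closed unit ball, let $g(x)=1-\|x\|^2$, and let $\mu$ be the equilibrium measure of $\mathbb{B}^d$, i.e. the probability measure on $\mathbb{B}^d$ proportional to $\frac{dx}{\sqrt{1-\|x\|^2}}$. Let $g\cdot\mu$ be the (not normalized) measure $g\,d\mu$ on $\mathbb{B}^d$. Then for every $m\in\mathbb{N}$, $$P^{\mu}_m(x,x)+g(x)\,P^{g\cdot\mu}_{m-1}(x,x)=\binom{d+m-1}{d-1}+\binom{d+m-2}{d-1},\qquad\forall x\in\mathbb{R}^d.$$ As a consequence, for every $n\in\mathbb{N}$, $$\Lambda^{\mu}_n(x)^{-1}+g(x)\,\Lambda^{g\cdot\mu}_{n-1}(x)^{-1}=\binom{d+n}{d}+\binom{d+n-1}{d},\qquad\forall x\in\mathbb{R}^d.$$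
   Context: $\mathbb{N}=\{0,1,2,\dots\}$; $\|\cdot\|$ is the Euclidean norm; $\mathbb{R}[x]_n$ is the space of real polynomials in $x=(x_1,\dots,x_d)$ of total degree at most $n$. For a finite nonnegative Borel measure $\nu$ (not necessarily a probability measure) with compact support and $\int p^2\,d\nu>0$ for all nonzero polynomials $p$, let $\mathcal{V}_m$ be the space of polynomials of degree $m$ orthogonal in $L^2(\nu)$ to all polynomials of degree less than $m$ (together with $0$). For any orthonormal basis $(P_\alpha)_{|\alpha|=m}$ of $\mathcal{V}_m$ in $L^2(\nu)$, $P^\nu_m(x,y)=\sum_{|\alpha|=m}P_\alpha(x)P_\alpha(y)$, the reproducing kernel of $\mathcal V_m$ (independent of the basis). The Christoffel function is $\Lambda^\nu_n(\xi)=\inf\{\int p^2\,d\nu: p\in\mathbb{R}[x]_n,\ p(\xi)=1\}$; equivalently $\Lambda^\nu_n(x)^{-1}=\sum_{m=0}^n P^\nu_m(x,x)$ for all $x\in\mathbb{R}^d$. Conventions: $P^\nu_{-1}=0$, $(\Lambda^\nu_{-1})^{-1}=0$, and $\binom{a}{b}=0$ whenever $a<b$ (including negative $a$). *)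

(* Defs.v *)
(* mpoly is imported without its notations, whose levels clash with those of
   mathcomp-analysis, and before mathcomp-analysis, because it declares an
   unrelated structure [measure].  Without the notations, [multinom d] is the
   type of multi-indices in N^d, [bmultinom d k] the finite type of those of
   total degree < k, [mpoly d R] the ring R[x_1, ..., x_d], and
   [mmeasure mdeg p] is 1 + the total degree of p (and 0 when p = 0). *)
From HB Require Import structures.
From mathcomp Require Import all_boot all_order all_algebra.
From mathcomp.multinomials Require Export -(notations) mpoly.
From mathcomp Require Import all_classical all_reals all_analysis measurable_realfun.

Set Implicit Arguments.
Unset Strict Implicit.
Unset Printing Implicit Defensive.

Import Order.TTheory GRing.Theory Num.Theory.
Import numFieldNormedType.Exports.

Local Open Scope classical_set_scope.
Local Open Scope ring_scope.

Section mdensity.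
Context {disp : measure_display} {T : measurableType disp} {R : realType}.
Variables (nu : {measure set T -> \bar R}) (D : set T) (f : T -> R).

(* The measure f . nu carried by D.  The hypotheses do not occur in the value;
   they are arguments so that the measure structure below is inferred. *)
Definition mdensity & measurable D & measurable_fun D f
    & (forall x, D x -> 0 <= f x) : set T -> \bar R :=
  fun A => (\int[nu]_(x in A `&` D) (f x)%:E)%E.

Hypotheses (mD : measurable D) (mf : measurable_fun D f)
  (f0 : forall x, D x -> 0 <= f x).

Local Notation fnu := (mdensity mD mf f0).

Let mdensity0 : fnu set0 = 0%E.
Proof. by rewrite /mdensity set0I integral_set0. Qed.

Let mdensity_ge0 A : (0 <= fnu A)%E.
Proof. by apply: integral_ge0 => x [_ /f0]; rewrite lee_fin. Qed.

Let mdensity_sigma_additive : semi_sigma_additive fnu.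
Proof.
move=> F mF tF mUF; rewrite /mdensity; apply: cvg_toP.
  apply: ereal_nondecreasing_is_cvgn => m n mn.
  apply: lee_sum_nneg_natr => // k _ _; exact: mdensity_ge0.
rewrite setI_bigcupl ge0_integral_bigcup//=.
- by move=> k; exact: measurableI.
- apply/measurable_EFinP; apply: measurable_funS mf => //.
  by apply: bigcup_sub => k _; exact: subIsetr.
- by move=> x [k _ [_ /f0]]; rewrite lee_fin.
- exact: trivIset_setIr.
Qed.

HB.instance Definition _ := isMeasure.Build _ _ _ fnu
  mdensity0 mdensity_ge0 mdensity_sigma_additive.

End mdensity.

(* R^n is [n.-tuple R], which the library equips with the product
   sigma-algebra but not with Lebesgue measure. *)

Section lebesgue_tuple.
Context {R : realType}.

Definition tuple_cons n (z : R * n.-tuple R) : n.+1.-tuple R :=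
  [tuple of z.1 :: z.2].

Lemma measurable_tuple_cons n : measurable_fun setT (@tuple_cons n).
Proof. exact: (measurable_cons measurable_fst measurable_snd). Qed.

Definition tuple_uncons n (x : n.+1.-tuple R) : R * n.-tuple R :=
  (thead x, [tuple of behead x]).

Lemma tuple_consK n : cancel (@tuple_cons n) (@tuple_uncons n).
Proof. by case=> a x; congr pair; apply: val_inj. Qed.

Lemma measurable_tuple_uncons n : measurable_fun setT (@tuple_uncons n).
Proof.
by apply/measurable_fun_pair; [exact: measurable_tnth|exact: measurable_behead].
Qed.

Section step.
Variables (n : nat) (nu : {sigma_finite_measure set (n.-tuple R) -> \bar R}).

Definition lebesgue_tuple_step : set (n.+1.-tuple R) -> \bar R :=
  pushforward (@lebesgue_measure R \x nu)%E (@tuple_cons n).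

Let step0 : lebesgue_tuple_step set0 = 0%E.
Proof. by rewrite /lebesgue_tuple_step /pushforward preimage_set0 measure0. Qed.

Let step_ge0 A : (0 <= lebesgue_tuple_step A)%E.
Proof. by rewrite /lebesgue_tuple_step /pushforward measure_ge0. Qed.

Let step_sigma_additive : semi_sigma_additive lebesgue_tuple_step.
Proof.
move=> F mF tF mUF; rewrite /lebesgue_tuple_step /pushforward preimage_bigcup.
apply: measure_semi_sigma_additive.
- by move=> k; rewrite -[X in measurable X]setTI; exact: measurable_tuple_cons.
- apply/trivIsetP => /= i j _ _ ij; rewrite -preimage_setI.
  by move/trivIsetP : tF => /(_ _ _ _ _ ij) ->//; rewrite preimage_set0.
- rewrite -preimage_bigcup -[X in measurable X]setTI.
  exact: measurable_tuple_cons.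
Qed.

HB.instance Definition _ := isMeasure.Build _ _ _ lebesgue_tuple_step
  step0 step_ge0 step_sigma_additive.

Let step_sigma_finite : sigma_finite setT lebesgue_tuple_step.
Proof.
have /sigma_finiteP[F [FT ndF Foo]] := sigma_finiteT (@lebesgue_measure R).
have /sigma_finiteP[G [GT ndG Goo]] := sigma_finiteT nu.
exists (fun k => @tuple_uncons n @^-1` (F k `*` G k)).
  rewrite -preimage_bigcup (_ : \bigcup_k _ = setT) ?preimage_setT//.
  apply/seteqP; split => // -[a x] _.
  have [i _ Fia] : (\bigcup_k F k) a by rewrite -FT.
  have [j _ Gjx] : (\bigcup_k G k) x by rewrite -GT.
  exists (maxn i j) => //; split => /=.
  - by move: Fia; exact/subsetPset/ndF/leq_maxl.
  - by move: Gjx; exact/subsetPset/ndG/leq_maxr.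
move=> k; have [mFk Fkoo] := Foo k; have [mGk Gkoo] := Goo k; split.
  rewrite -[X in measurable X]setTI; apply: measurable_tuple_uncons => //.
  exact: measurableX.
rewrite /lebesgue_tuple_step /pushforward -comp_preimage.
rewrite (_ : @tuple_uncons n \o @tuple_cons n = id); last first.
  by apply/funext => z /=; rewrite tuple_consK.
by rewrite preimage_id product_measure1E// lte_mul_pinfty// ge0_fin_numE.
Qed.

HB.instance Definition _ := Measure_isSigmaFinite.Build _ _ _
  lebesgue_tuple_step step_sigma_finite.

End step.

Fixpoint lebesgue_tuple n : {sigma_finite_measure set (n.-tuple R) -> \bar R} :=
  if n is n'.+1 then lebesgue_tuple_step (lebesgue_tuple n')
  else @dirac _ (0.-tuple R) [tuple] R.

Lemma lebesgue_tuple_box n (A : 'I_n -> set R) : (forall i, measurable (A i)) ->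
  lebesgue_tuple n [set x | forall i, A i (tnth x i)] =
  (\prod_(i < n) lebesgue_measure (A i))%E.
Proof.
elim: n A => [|n IHn] A mA.
  by rewrite big_ord0 /= diracE mem_set// => -[].
have mB : measurable [set x : n.-tuple R | forall i, A (lift ord0 i) (tnth x i)].
  rewrite (_ : [set _ | _] =
      \bigcap_(i in [set: 'I_n]) ((@tnth n R ^~ i) @^-1` A (lift ord0 i))).
    apply: fin_bigcap_measurable => // i _.
    by rewrite -[X in measurable X]setTI; exact: measurable_tnth.
  by apply/seteqP; split => [x + i _|x + i] /=; apply.
rewrite big_ord_recl -IHn//= -product_measure1E//; last exact: mA.
congr (product_measure1 _ _ _); apply/seteqP; split => -[a x] /=.
  move=> Ax; split; first exact: (Ax ord0).
  by move=> i; have := Ax (lift ord0 i); rewrite tnthS.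
case=> Aa Ax i; case: (unliftP ord0 i) => [j ->|->//].
by rewrite tnthS.
Qed.

End lebesgue_tuple.

Section ball.
Context {R : realType} (d : nat).
Implicit Type x : d.-tuple R.

Definition enorm x : R := Num.sqrt (\sum_(i < d) tnth x i ^+ 2).

Definition ball_poly x : R := 1 - enorm x ^+ 2.

Definition unit_ball : set (d.-tuple R) := [set x | 0 <= ball_poly x].

Definition ball_weight x : R := (Num.sqrt (ball_poly x))^-1.

Lemma measurable_sqrtr : measurable_fun setT (@Num.sqrt R).
Proof. by apply: continuous_measurable_fun; exact: sqrt_continuous. Qed.

Lemma measurable_ball_poly : measurable_fun setT ball_poly.
Proof.
apply: measurable_funB => //; apply: measurable_funX.
apply: (measurableT_comp measurable_sqrtr).
by apply: measurable_sum => i; apply: measurable_funX; exact: measurable_tnth.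
Qed.

Lemma measurable_unit_ball : measurable unit_ball.
Proof.
rewrite (_ : unit_ball = setT `&` ball_poly @^-1` `[0, +oo[).
  by apply: measurable_ball_poly => //; exact: measurable_itv.
by apply/seteqP; split => x /=; rewrite in_itv/= andbT //; case.
Qed.

Lemma ball_poly_ge0 x : unit_ball x -> 0 <= ball_poly x.
Proof. by []. Qed.

Lemma ball_weight_ge0 x : unit_ball x -> 0 <= ball_weight x.
Proof. by rewrite invr_ge0 sqrtr_ge0. Qed.

Lemma measurable_ball_weight : measurable_fun unit_ball ball_weight.
Proof.
apply: (@eq_measurable_fun _ _ _ _ _
    (fun x => (Num.sqrt (ball_poly x)) `^ (-1))).
  by move=> x _; rewrite powR_inv1// sqrtr_ge0.
apply: measurable_funTS.
have := measurableT_comp measurable_sqrtr measurable_ball_poly.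
exact: (measurableT_comp (@measurable_powR R (-1))).
Qed.

(* dx / sqrt (1 - |x|^2) on the unit ball; since 0^-1 = 0 the density is 0 on
   the unit sphere, which is a null set. *)
Definition ball_weight_measure : {measure set (d.-tuple R) -> \bar R} :=
  mdensity (lebesgue_tuple d) measurable_unit_ball measurable_ball_weight
    ball_weight_ge0.

(* The total mass of [ball_weight_measure] is positive and finite, so that the
   default value required by [mnormalize] is irrelevant. *)
Definition equilibrium : probability (d.-tuple R) R :=
  mnormalize ball_weight_measure (\d_([tuple 0 | _ < d] : d.-tuple R)).

Definition ball_poly_equilibrium : {measure set (d.-tuple R) -> \bar R} :=
  mdensity equilibrium measurable_unit_ball
    (measurable_funTS measurable_ball_poly) ball_poly_ge0.

End ball.

Section orthogonal_polynomials.
Context {R : realType} (d : nat) (nu : {measure set (d.-tuple R) -> \bar R}).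
Implicit Types (p q : mpoly d R) (x y xi : d.-tuple R).

Definition peval p x : R := meval (tnth x) p.

Definition poly_inner p q : R := \int[nu]_x (peval p x * peval q x).

(* The space V_m of nu; [mmeasure mdeg] is shifted by one. *)
Definition orth_space (m : nat) : set (mpoly d R) :=
  [set p | (p = 0 \/ mmeasure mdeg p = m.+1) /\
     forall q, (mmeasure mdeg q <= m)%N -> poly_inner p q = 0].

(* Only the values P a with |a| = m are relevant. *)
Definition orthonormal_basis (m : nat) (P : multinom d -> mpoly d R) :=
  [/\ forall a, mdeg a = m -> orth_space m (P a),
      forall a b, mdeg a = m -> mdeg b = m ->
        poly_inner (P a) (P b) = (a == b)%:R
    & forall p, orth_space m p -> exists c : multinom d -> R,
        p = \sum_(a : bmultinom d m.+1 | mdeg a == m) c a *: P a].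

(* The reproducing kernel P^nu_m(x, y) of V_m.  It does not depend on the
   orthonormal basis, which is picked by choice; P^nu_m = 0 for m < 0. *)
Definition rkernel (m : int) x y : R :=
  if m is Posz k then
    let P := xget (fun=> 0) [set P | orthonormal_basis k P] in
    \sum_(a : bmultinom d k.+1 | mdeg a == k) peval (P a) x * peval (P a) y
  else 0.

Definition christoffel (n : nat) xi : R :=
  inf [set \int[nu]_x (peval p x ^+ 2) | p in
        [set p | (mmeasure mdeg p <= n.+1)%N /\ peval p xi = 1]].

Definition inv_christoffel (n : int) xi : R :=
  if n is Posz k then (christoffel k xi)^-1 else 0.

End orthogonal_polynomials.

(* An integer upper argument is needed: for d = 1 and m = 0 the binomial
   coefficient (d + m - 2 choose d - 1) is (-1 choose 0), which is 0 here, while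
   truncated subtraction would give (0 choose 0) = 1. *)
Definition binz (a : int) (b : nat) : nat := if a is Posz k then 'C(k, b) else 0.

(* Main.v *)
Require Import Defs.
From mathcomp Require Import all_boot all_order all_algebra.
From mathcomp Require Import finmap.
From mathcomp Require Import all_classical all_reals all_analysis measurable_realfun.
From mathcomp Require Import ring lra.

(** Let L(p) be the integral of the polynomial p against the equilibrium measure
    mu, and G = 1 - (x_1^2 + ... + x_d^2).  The whole theorem follows from the
    identity L(G d_i q) = L(x_i q), which says that the integral over the ball of
    the i-th partial derivative of sqrt(G) q vanishes because sqrt(G) is zero on
    the sphere.

    The ball is the shadow of the sphere S^d, and polynomials on the sphere are
    sums f + s h with s^2 = G: the spherical harmonics of degree m are
    V_m(mu) + s V_{m-1}(g mu), and the left hand side of the first identity is the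
    restriction of their reproducing kernel to the diagonal.  It is constant by
    rotation invariance.  The proof uses only the infinitesimal rotations in the
    planes (x_i, s); they act on the pairs (f, h) by f |-> d_i f and
    h |-> G d_i h - x_i h.  By the identity above these two maps are adjoint to
    each other up to sign ([mderiv_adjoint]) and exchange V_m(mu) with
    V_{m-1}(g mu) ([mderiv_orth_space], [coderiv_orth_space]).  Expanding the
    images in orthonormal bases gives an antisymmetric matrix, hence all the
    partial derivatives of the polynomial
      K = sum_a e_a^2 + G sum_b u_b^2
    vanish ([mderiv_kernel_eq0]).  So K is constant, and its value is L(K), the
    number of elements of the two bases, which is the sum of two binomial
    coefficients.

    The existence of these bases needs L(p^2) > 0 for p <> 0, and this too comes
    from the integration by parts: if L(p^2) = 0 then p lies in the radical of L,
    the radical is stable under p |-> G d_i p, so that it contains a power of G,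
    and the recursion (2k+1) L(G^k) = (2k+1+d) L(G^(k+1)) shows that L(G^k) > 0
    ([null_eq0]).

    The Christoffel function is the inverse of the sum of the kernels of degree
    at most n, by the reproducing property ([inv_christoffelE]), and the second
    identity is the sum of the first over the degrees.

    The analysis consists in the finiteness of the integral of
    (c - |x|^2)^(-1/2) and in the integration by parts for products of univariate
    polynomials.  Both go by induction on the dimension, with the radius as a
    parameter: by the theorem of Fubini, fixing some coordinates turns the weight
    into the weight of a ball of smaller dimension and radius, and the case of
    one variable is the fundamental theorem of calculus
    ([integral_arcsine_density_le], [arcsine_by_parts], [weight_by_parts]). *)

Set Implicit Arguments.
Unset Strict Implicit.
Unset Printing Implicit Defensive.

Import Order.TTheory GRing.Theory Num.Theory.
Import numFieldNormedType.Exports.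
Local Open Scope classical_set_scope.
Local Open Scope ring_scope.

(** * Inner products and graded orthonormalization *)

Record is_inner_product (R : rcfType) (V : lmodType R) (ip : V -> V -> R) :
    Prop := IsInnerProduct {
  ipC : forall p q, ip p q = ip q p;
  ip_linear : forall a p q r, ip (a *: p + q) r = a * ip p r + ip q r;
  ip_ge0 : forall p, 0 <= ip p p;
  ip_eq0 : forall p, ip p p = 0 -> p = 0 }.

Section inner_product.
Variables (R : rcfType) (V : lmodType R) (ip : V -> V -> R).
Hypothesis ipP : is_inner_product ip.

Lemma ipDl p q r : ip (p + q) r = ip p r + ip q r.
Proof. by rewrite -[p]scale1r (ip_linear ipP) mul1r scale1r. Qed.

Lemma ip0l r : ip 0 r = 0.
Proof. by apply: (addrI (ip 0 r)); rewrite -ipDl !addr0. Qed.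

Lemma ipZl a p r : ip (a *: p) r = a * ip p r.
Proof. by rewrite -[a *: p]addr0 (ip_linear ipP) ip0l addr0. Qed.

Lemma ipBl p q r : ip (p - q) r = ip p r - ip q r.
Proof. by rewrite ipDl -scaleN1r ipZl mulN1r. Qed.

Lemma ip_suml (I : Type) (s : seq I) (P : pred I) (F : I -> V) r :
  ip (\sum_(i <- s | P i) F i) r = \sum_(i <- s | P i) ip (F i) r.
Proof.
by apply: (big_morph (ip^~ r)) => [p q|]; [exact: ipDl|exact: ip0l].
Qed.

Lemma ip0r r : ip r 0 = 0. Proof. by rewrite (ipC ipP) ip0l. Qed.

Lemma ipBr p q r : ip r (p - q) = ip r p - ip r q.
Proof. by rewrite !(ipC ipP r) ipBl. Qed.

Lemma ipZr a p r : ip r (a *: p) = a * ip r p.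
Proof. by rewrite !(ipC ipP r) ipZl. Qed.

Lemma ip_sumr (I : Type) (s : seq I) (P : pred I) (F : I -> V) r :
  ip r (\sum_(i <- s | P i) F i) = \sum_(i <- s | P i) ip r (F i).
Proof. by rewrite (ipC ipP) ip_suml; apply: eq_bigr => i _; rewrite (ipC ipP). Qed.

Lemma ip_gt0 p : p != 0 -> 0 < ip p p.
Proof.
move=> p0; rewrite lt0r (ip_ge0 ipP) andbT.
by apply: contra p0 => /eqP /(ip_eq0 ipP) ->.
Qed.

End inner_product.

(** The degenerate case of Cauchy-Schwarz, for a form that is not known to be
    definite: otherwise B(q + t p, q + t p) would be an affine function of t that
    takes negative values. *)
Lemma isotropic_orthogonal (R : rcfType) (V : lmodType R) (B : V -> V -> R) :
  (forall p q, B p q = B q p) ->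
  (forall a p q r, B (a *: p + q) r = a * B p r + B q r) ->
  (forall p, 0 <= B p p) ->
  forall p, B p p = 0 -> forall q, B p q = 0.
Proof.
move=> BC Blin Bge0 p pp q; apply/eqP; apply: contraT => pq0.
(* B(t p + q, t p + q) = 2 t B(p, q) + B(q, q) is equal to -1 for this t *)
pose t := - (B q q + 1) / (2 * B p q).
have := Bge0 (t *: p + q).
rewrite Blin ![B _ (t *: p + q)]BC !Blin pp (BC q p) /t.
have -> : - (B q q + 1) / (2 * B p q) *
      (- (B q q + 1) / (2 * B p q) * 0 + B p q) +
    (- (B q q + 1) / (2 * B p q) * B p q + B q q) = - 1 by field.
by rewrite ler0N1.
Qed.

Section graded_gram_schmidt.
Variables (R : rcfType) (d : nat) (ip : mpoly d R -> mpoly d R -> R).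
Hypothesis ipP : is_inner_product ip.
Local Notation X a := (@mpolyX d R a).
Local Notation msize := (mmeasure (@mdeg d)).

(** The step of the induction adds to the family a multi-index t of largest degree.
    The third property, that the monomials outside the family do not occur in
    the polynomials built so far, keeps the coefficient of X^t in the residue of
    X^t equal to 1, so that this residue can be normalized; it replaces an
    argument of linear independence. *)
Let gram_schmidt_seq (s : seq (multinom d)) :
    uniq s -> sorted (fun a b => mdeg b <= mdeg a)%N s ->
  exists e : multinom d -> mpoly d R,
  [/\ {in s &, forall a b, ip (e a) (e b) = (a == b)%:R},
      {in s, forall a,
         X a = \sum_(b <- s | (mdeg b <= mdeg a)%N) ip (X a) (e b) *: e b},
      forall a t, a \in s -> t \notin s -> mcoeff t (e a) = 0
    & {in s, forall a, msize (e a) <= (mdeg a).+1}%N].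
Proof.
elim: s => [|t s IHs] /=; first by exists (fun=> 0); split.
move=> /andP[ts us] ps.
have [e [e_orth e_span e_supp e_deg]] := IHs us (path_sorted ps).
have s_le b : b \in s -> (mdeg b <= mdeg t)%N.
  move: ps; rewrite path_sortedE; first by case/andP => /allP h _ /h.
  by move=> x y z h1 h2; exact: leq_trans h2 h1.
(* the residue of X^t; the new polynomial is r / |r| *)
pose r := X t - \sum_(b <- s) ip (X t) (e b) *: e b.
have rt : mcoeff t r = 1.
  rewrite mcoeffB mcoeffX eqxx raddf_sum big1_seq ?subr0// => b /= bs.
  by rewrite mcoeffZ e_supp// mulr0.
have r0 : r != 0 by apply/eqP => r0; move/eqP: rt; rewrite r0 mcoeff0 eq_sym oner_eq0.
have r_orth b : b \in s -> ip r (e b) = 0.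
  move=> bs; rewrite (ipBl ipP) (ip_suml ipP) (bigD1_seq b)//= (ipZl ipP).
  rewrite e_orth// eqxx mulr1 big1_seq ?addr0 ?subrr// => c /= /andP[cb cs].
  by rewrite (ipZl ipP) e_orth// (negPf cb) mulr0.
pose nr := Num.sqrt (ip r r).
have nr2 : nr * nr = ip r r by rewrite -expr2 sqr_sqrtr// (ip_ge0 ipP).
have nr0 : nr != 0 by rewrite gt_eqF// sqrtr_gt0 (ip_gt0 ipP).
pose e' a := if a == t then nr^-1 *: r else e a.
have e't : e' t = nr^-1 *: r by rewrite /e' eqxx.
have e's b : b \in s -> e' b = e b.
  by move=> bs; rewrite /e'; case: eqP => // bt; rewrite -bt bs in ts.
clearbody e'.
have et_orth b : b \in s -> ip (e' t) (e b) = 0.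
  by move=> bs; rewrite e't (ipZl ipP) r_orth// mulr0.
have rE : r = nr *: e' t by rewrite e't scalerA mulfV// scale1r.
have XtE : X t = nr *: e' t + \sum_(b <- s) ip (X t) (e b) *: e b.
  by rewrite -rE /r subrK.
have e'tt : ip (e' t) (e' t) = 1.
  by rewrite e't (ipZl ipP) (ipZr ipP) -nr2 mulKf// mulVf.
have ipXt : ip (X t) (e' t) = nr.
  rewrite XtE (ipDl ipP) (ipZl ipP) e'tt mulr1 (ip_suml ipP) big1_seq ?addr0//.
  by move=> b /= bs; rewrite (ipZl ipP) (ipC ipP (e b)) et_orth// mulr0.
exists e'; split.
- move=> a b; rewrite !inE.
  have [->|at_] := eqVneq a t; have [->|bt] := eqVneq b t => //=.
  + by move=> _ bs; rewrite (e's b)// et_orth// eq_sym (negPf bt).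
  + by move=> as_ _; rewrite (e's a)// (ipC ipP) et_orth// (negPf at_).
  + by move=> as_ bs; rewrite !e's// e_orth.
- move=> a; rewrite inE big_cons; have [->|at_] := eqVneq a t => //=.
    rewrite leqnn ipXt => _; rewrite {1}XtE; congr (_ + _).
    rewrite [RHS]big_seq_cond [LHS]big_seq; apply: eq_big.
      by move=> b; case bs : (b \in s) => //=; rewrite s_le.
    by move=> b bs; rewrite e's.
  move=> as_.
  have {1}-> : X a = \sum_(b <- s | (mdeg b <= mdeg a)%N) ip (X a) (e' b) *: e' b.
    rewrite {1}e_span// big_seq_cond [RHS]big_seq_cond.
    by apply: eq_bigr => b /andP[bs _]; rewrite e's.
  case: ifP => // _.
  suff -> : ip (X a) (e' t) = 0 by rewrite scale0r add0r.
  rewrite e_span// (ip_suml ipP) big_seq_cond big1// => b /andP[bs _].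
  by rewrite (ipZl ipP) (ipC ipP (e b)) et_orth// mulr0.
- move=> a b; rewrite !inE negb_or; have [->|at_] := eqVneq a t => //=.
    move=> _ /andP[bt bs]; rewrite e't mcoeffZ mcoeffB mcoeffX eq_sym (negPf bt).
    rewrite raddf_sum big1_seq ?subr0 ?mulr0// => c /= cs.
    by rewrite mcoeffZ e_supp// mulr0.
  by move=> as_ /andP[bt bs]; rewrite e's// e_supp.
- move=> a; rewrite !inE; have [->|at_] := eqVneq a t => /=.
    move=> _; rewrite e't; apply: leq_trans (mmeasureZ_le _ _ _) _.
    rewrite /r; apply: leq_trans (mmeasureD_le _ _ _) _.
    rewrite geq_max mmeasureX leqnn/= mmeasureN.
    apply: leq_trans (mmeasure_sum _ _ _ _) _.
    apply/bigmax_leqP_seq => b bs _; apply: leq_trans (mmeasureZ_le _ _ _) _.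
    by apply: leq_trans (e_deg _ bs) _; rewrite ltnS s_le.
  by move=> as_; rewrite e's// e_deg.
Qed.

(** The second property holds for every k because monomials are treated by
    increasing degree; it makes the e_a of degree exactly m orthogonal to all
    polynomials of degree less than m. *)
Lemma graded_orthonormal_family N : exists e : multinom d -> mpoly d R,
  [/\ forall a b, (mdeg a < N)%N -> (mdeg b < N)%N ->
        ip (e a) (e b) = (a == b)%:R,
      forall k p, (k <= N)%N -> (msize p <= k)%N ->
        p = \sum_(b : bmultinom d k) ip p (e b) *: e b
    & forall a, (mdeg a < N)%N -> (msize (e a) <= (mdeg a).+1)%N].
Proof.
pose s0 := [seq bmnm a | a <- enum {: bmultinom d N}].
pose s := sort (fun a b => mdeg b <= mdeg a)%N s0.
have us0 : uniq s0 by rewrite map_inj_uniq ?enum_uniq//; exact: val_inj.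
have us : uniq s by rewrite sort_uniq.
have ss : sorted (fun a b => mdeg b <= mdeg a)%N s.
  by apply: sort_sorted => a b; exact: leq_total.
have mems a : (a \in s) = (mdeg a < N)%N.
  rewrite mem_sort; apply/mapP/idP => [[b _ ->]|aN]; first exact: bmdeg.
  by exists (BMultinom aN) => //; rewrite mem_enum.
have [e [e_orth e_span e_supp e_deg]] := gram_schmidt_seq us ss.
exists e; split => [a b aN bN|k p kN pk|a aN].
- by apply: e_orth; rewrite mems.
- have E a : (mdeg a < N)%N -> X a =
    \sum_(b <- s | (mdeg b <= mdeg a)%N) ip (X a) (e b) *: e b.
    by move=> aN; apply: e_span; rewrite mems.
  have e_self a : (mdeg a < k)%N ->
      e a = \sum_(b : bmultinom d k) ip (e a) (e b) *: e b.
    move=> ak; rewrite (bigD1 (BMultinom ak))//= e_orth ?mems ?(leq_trans ak)//.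
    rewrite eqxx scale1r big1 ?addr0// => b ba.
    rewrite e_orth ?mems ?(leq_trans ak) ?(leq_trans (bmdeg b))//.
    move: ba; rewrite -val_eqE/= eq_sym => /negPf ->.
    by rewrite scale0r.
  have lin (I : Type) (r : seq I) (P : pred I) (c : I -> R) F :
      (forall i, P i -> F i = \sum_(b : bmultinom d k) ip (F i) (e b) *: e b) ->
      \sum_(i <- r | P i) c i *: F i = \sum_(b : bmultinom d k)
        ip (\sum_(i <- r | P i) c i *: F i) (e b) *: e b.
    move=> FE; under [RHS]eq_bigr do rewrite (ip_suml ipP) scaler_suml.
    rewrite exchange_big; apply: eq_bigr => i Pi; rewrite {1}FE// scaler_sumr.
    by apply: eq_bigr => b _; rewrite scalerA (ipZl ipP).
  rewrite (mpolywE pk); apply: (lin) => a _.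
  have aN := leq_trans (bmdeg a) kN.
  rewrite [X _](E _ aN); apply: (lin) => b ba; apply: e_self.
  exact: leq_ltn_trans ba (bmdeg a).
- by apply: e_deg; rewrite mems.
Qed.

End graded_gram_schmidt.

(** * Degrees and partial derivatives of polynomials *)

Section mpoly_degree.
Variables (R : realFieldType) (d : nat).
Implicit Types p q : mpoly d R.
Local Notation X i := (@mpolyX d R (mnm1 i)).
Local Notation msize := (mmeasure (@mdeg d)).

Lemma msize_leP p k :
  (msize p <= k)%N <-> forall m, (k <= mdeg m)%N -> mcoeff m p = 0.
Proof.
split=> [pk m km|h].
  apply: memN_msupp_eq0; apply/negP => /(@msize_mdeg_lt _ _ p m) mp.
  by have := leq_trans (leq_trans mp pk) km; rewrite ltnn.
rewrite mmeasureE; apply/bigmax_leqP_seq => m mp _; rewrite ltnNge.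
by apply/negP => /h /eqP; rewrite mcoeff_eq0 mp.
Qed.

Lemma msize_mderiv i p k : (msize p <= k.+1)%N -> (msize (mderiv i p) <= k)%N.
Proof.
move=> /msize_leP pk; apply/msize_leP => m km.
by rewrite mcoeff_mderiv pk ?mul0rn// mdegD mdeg1 addn1.
Qed.

Lemma msize_mul_le p q k l :
  (msize p <= k.+1)%N -> (msize q <= l)%N -> (msize (p * q) <= k + l)%N.
Proof.
move=> pk ql; have [->|p0] := eqVneq p 0; first by rewrite mul0r mmeasure0.
have [->|q0] := eqVneq q 0; first by rewrite mulr0 mmeasure0.
rewrite msizeM//; apply: leq_trans (_ : ((k.+1 + l).-1 <= _)%N) => //.
by rewrite -!subn1 leq_sub// leq_add.
Qed.

Lemma mderiv_var i j : mderiv i (X j) = (i == j)%:R.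
Proof.
rewrite mderivX mnm1E eq_sym; case: eqP => [->|_]; last by rewrite scale0r.
rewrite scale1r (_ : mnm_sub _ _ = @mnm0 d) ?mpolyX0//.
by apply/mnmP => k; rewrite mnmBE subnn mnm0E.
Qed.

Lemma mderiv_eq0 p : (forall i, mderiv i p = 0) -> p = mpolyC d (mcoeff (@mnm0 d) p).
Proof.
move=> h; apply/mpolyP => m; rewrite mcoeffC.
have [->|m0] := eqVneq m (@mnm0 d); first by rewrite mulr1.
rewrite mulr0; have [i mi|m0'] := pickP (fun i => m i != 0%N); last first.
  by case/eqP: m0; apply/mnmP => i; rewrite mnm0E; apply/eqP/negbFE/m0'.
have := congr1 (mcoeff (mnm_sub m (mnm1 i))) (h i).
rewrite mcoeff0 mcoeff_mderiv submK ?lep1mP// => /eqP.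
by rewrite mulrn_eq0 => /orP[//|/eqP].
Qed.

End mpoly_degree.

(** * Positive functionals with the integration by parts of the ball *)

Section ball_functional.
Variables (R : rcfType) (d : nat) (L : mpoly d R -> R).
Implicit Types p q f h : mpoly d R.
Local Notation X i := (@mpolyX d R (mnm1 i)).
Local Notation msize := (mmeasure (@mdeg d)).

Definition ball_mpoly : mpoly d R := 1 - \sum_(i < d) X i ^+ 2.
Local Notation G := ball_mpoly.

(** What the proof uses of the integral against the equilibrium measure. *)
Record ball_functional : Prop := BallFunctional {
  bf_linear : forall a p q, L (a *: p + q) = a * L p + L q;
  bf_1 : L 1 = 1;
  bf_sqr_ge0 : forall p, 0 <= L (p * p);
  bf_ball_sqr_ge0 : forall p, 0 <= L (G * (p * p));
  bf_by_parts : forall i q, L (G * mderiv i q) = L (X i * q) }.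

Hypothesis LP : ball_functional.

Lemma bfD p q : L (p + q) = L p + L q.
Proof. by rewrite -[p]scale1r (bf_linear LP) mul1r scale1r. Qed.

Lemma bf0 : L 0 = 0.
Proof. by apply: (addrI (L 0)); rewrite -bfD !addr0. Qed.

Lemma bfZ a p : L (a *: p) = a * L p.
Proof. by rewrite -[a *: p]addr0 (bf_linear LP) bf0 addr0. Qed.

Lemma bfN p : L (- p) = - L p.
Proof. by rewrite -scaleN1r bfZ mulN1r. Qed.

Lemma bfB p q : L (p - q) = L p - L q. Proof. by rewrite bfD bfN. Qed.

Lemma bf_sum (I : Type) (s : seq I) (P : pred I) (F : I -> mpoly d R) :
  L (\sum_(i <- s | P i) F i) = \sum_(i <- s | P i) L (F i).
Proof. by apply: (big_morph L) => [p q|]; [exact: bfD|exact: bf0]. Qed.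

Lemma mderiv_ball i : mderiv i G = - (X i *+ 2).
Proof.
rewrite /G mderivB -mpolyC1 mderivC sub0r; congr (- _).
rewrite raddf_sum (bigD1 i)//= big1 => [|j ji].
  by rewrite expr2 mderivM mderiv_var eqxx mul1r mulr1 addr0.
by rewrite expr2 mderivM mderiv_var eq_sym (negPf ji) mul0r mulr0 addr0.
Qed.

(** The factor G avoids the predecessor of k in the exponent. *)
Lemma mderiv_ballX i k : G * mderiv i (G ^+ k) = - (X i * G ^+ k) *+ k.*2.
Proof.
elim: k => [|k IHk]; first by rewrite expr0 -mpolyC1 mderivC mulr0 mulr0n.
rewrite exprS mderivM mulrDr mderiv_ball (mulrCA G) IHk.
rewrite doubleS -[k.*2.+2]/(2 + k.*2)%N mulrnDr -[_ *+ k.*2]mulr_natr.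
rewrite -[in RHS](mulr_natr _ k.*2); ring.
Qed.

(** Integration by parts applied to x_i G^k gives
    (2k+1) L(x_i^2 G^k) = L(G^(k+1)); summing over i yields
    (2k+1) L(G^k) = (2k+1+d) L(G^(k+1)). *)
Lemma bf_ballX_gt0 k : 0 < L (G ^+ k).
Proof.
elim: k => [|k IHk]; first by rewrite expr0 (bf_1 LP) ltr01.
have byparts i : (1 + k.*2)%:R * L (X i ^+ 2 * G ^+ k) = L (G ^+ k.+1).
  have := bf_by_parts LP i (X i * G ^+ k).
  rewrite mderivM mderiv_var eqxx mul1r mulrDr bfD (mulrCA G) mderiv_ballX -exprS.
  have -> : X i * (- (X i * G ^+ k) *+ k.*2) = (- k.*2%:R) *: (X i ^+ 2 * G ^+ k).
    by rewrite scaleNr scaler_nat; ring.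
  by rewrite mulrA -expr2 bfZ natrD => E; lra.
have : \sum_(i < d) ((1 + k.*2)%:R * L (X i ^+ 2 * G ^+ k)) = L (G ^+ k.+1) *+ d.
  by rewrite (eq_bigr _ (fun i _ => byparts i)) sumr_const card_ord.
rewrite -mulr_sumr -bf_sum -mulr_suml.
have -> : \sum_(i < d) X i ^+ 2 = 1 - G by rewrite /G opprB addrC subrK.
rewrite mulrBl mul1r bfB -exprS mulrBr => /eqP.
rewrite subr_eq -[_ *+ d]mulr_natl -mulrDl => /eqP E.
have : 0 < ((d%:R + (1 + k.*2)%:R) * L (G ^+ k.+1)) by rewrite -E mulr_gt0// ltr0n.
by rewrite pmulr_rgt0// ltr_wpDl// ltr0n.
Qed.

(** The radical of the form (p, q) |-> L(p q); it is an ideal. *)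
Definition null_poly p := forall q, L (p * q) = 0.

Lemma null_sqr p : L (p * p) = 0 -> null_poly p.
Proof.
move=> pp q; apply: (isotropic_orthogonal (B := fun p q => L (p * q))) => //.
- by move=> ? ?; rewrite mulrC.
- by move=> a f g h; rewrite mulrDl -scalerAl (bf_linear LP).
- exact: bf_sqr_ge0.
Qed.

(** Expand L(G d_i(p q)) = L(x_i p q) by the product rule. *)
Lemma null_mderiv i p : null_poly p -> null_poly (G * mderiv i p).
Proof.
move=> np q; have := bf_by_parts LP i (p * q).
rewrite -mulrA mderivM mulrDr bfD [G * (p * _)]mulrCA np addr0 => ->.
by rewrite mulrCA np.
Qed.

(** Since the radical is an ideal stable under p |-> G d_i p, if it contains
    G^k q then it contains G^(k+1) d_i q for every i.  Differentiating q down to a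
    nonzero constant would put a power of G in the radical, against [bf_ballX_gt0]. *)
Lemma null_eq0 p : null_poly p -> p = 0.
Proof.
suff H k n q : (msize q <= n)%N -> null_poly (G ^+ k * q) -> q = 0.
  by move=> np; apply: (H 0%N _ p (leqnn _)); rewrite expr0 mul1r.
elim: n k q => [|n IHn] k q qn nq.
  by apply/eqP; rewrite -(msize_poly_eq0 q) -leqn0.
have dq i : mderiv i q = 0.
  apply: (IHn k.+1); first exact: msize_mderiv.
  move=> r; have := null_mderiv i nq r.
  rewrite mderivM mulrDr [G * (_ * q)]mulrA mderiv_ballX [G * (G ^+ k * _)]mulrA.
  rewrite -exprS mulrDl bfD.
  rewrite (_ : _ * q * r = G ^+ k * q * (- (X i * r) *+ k.*2)) ?nq ?add0r//.
  by ring.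
move: (mderiv_eq0 dq) (nq 1); set c := mcoeff _ q => qE.
rewrite mulr1 qE mulrC mul_mpolyC bfZ => /eqP.
rewrite mulf_eq0 (gt_eqF (bf_ballX_gt0 k)) orbF => /eqP ->.
exact: mpolyC0.
Qed.

Lemma inner_product_ball : is_inner_product (fun p q => L (p * q)).
Proof.
split=> [p q|a p q r|p|p /null_sqr/null_eq0//]; first by rewrite mulrC.
  by rewrite mulrDl -scalerAl (bf_linear LP).
exact: bf_sqr_ge0.
Qed.

Lemma ball_mpoly_neq0 : G != 0.
Proof.
apply/eqP => G0; have := bf_ballX_gt0 1.
by rewrite expr1 G0 bf0 ltxx.
Qed.

(** If L(G p^2) = 0 then G p is in the radical of L, and the ring of polynomials
    is an integral domain. *)
Lemma inner_product_ball_density : is_inner_product (fun p q => L (G * (p * q))).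
Proof.
have linG a p q r : L (G * ((a *: p + q) * r)) = a * L (G * (p * r)) + L (G * (q * r)).
  by rewrite [_ * r]mulrDl [G * _]mulrDr -scalerAl -scalerAr (bf_linear LP).
have symG p q : L (G * (p * q)) = L (G * (q * p)) by rewrite (mulrC p).
split=> // [p|p pp]; first exact: bf_ball_sqr_ge0.
have /null_eq0/eqP : null_poly (G * p).
  move=> q; rewrite -mulrA.
  apply: (isotropic_orthogonal (B := fun p q => L (G * (p * q)))) => //.
  exact: bf_ball_sqr_ge0.
by rewrite mulf_eq0 (negPf ball_mpoly_neq0) => /eqP.
Qed.

(** Up to the factor s = sqrt G, the action on s h of the infinitesimal rotation in
    the plane (x_i, s). *)
Definition coderiv i h := G * mderiv i h - X i * h.

(** The infinitesimal rotations are antisymmetric. *)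
Lemma mderiv_adjoint i f h : L (G * (mderiv i f * h)) = - L (f * coderiv i h).
Proof.
have := bf_by_parts LP i (f * h); rewrite mderivM [G * _]mulrDr bfD => E.
have -> : f * coderiv i h = G * (f * mderiv i h) - X i * (f * h).
  by rewrite /coderiv; ring.
by rewrite bfB -E opprB addrK.
Qed.

(** Both halves of the derivative are the double sum of e_a u_b with the matrix
    coefficients of the derivation, and these coefficients are opposite by
    [mderiv_adjoint]. *)
Lemma mderiv_kernel_eq0 (I J : finType) (PI : pred I) (PJ : pred J)
    (e : I -> mpoly d R) (u : J -> mpoly d R) i :
  (forall a, PI a ->
     mderiv i (e a) = \sum_(b | PJ b) L (G * (mderiv i (e a) * u b)) *: u b) ->
  (forall b, PJ b ->
     coderiv i (u b) = \sum_(a | PI a) L (coderiv i (u b) * e a) *: e a) ->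
  mderiv i (\sum_(a | PI a) e a * e a + G * \sum_(b | PJ b) u b * u b) = 0.
Proof.
move=> eE uE; rewrite mderivD mderivM mderiv_ball raddf_sum/=.
have -> : mderiv i (\sum_(b | PJ b) u b * u b) =
    \sum_(b | PJ b) mderiv i (u b * u b) by exact: raddf_sum.
rewrite !mulr_sumr -!big_split/=.
have -> : \sum_(b | PJ b) (- (X i *+ 2) * (u b * u b) + G * mderiv i (u b * u b)) =
    (\sum_(b | PJ b) u b * coderiv i (u b)) *+ 2.
  rewrite -sumrMnl; apply: eq_bigr => b _; rewrite mderivM /coderiv; ring.
have -> : \sum_(a | PI a) mderiv i (e a * e a) =
    (\sum_(a | PI a) e a * mderiv i (e a)) *+ 2.
  by rewrite -sumrMnl; apply: eq_bigr => a _; rewrite mderivM; ring.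
rewrite -mulrnDl (_ : _ + _ = 0) ?mul0rn//.
have -> : \sum_(a | PI a) e a * mderiv i (e a) = \sum_(a | PI a) \sum_(b | PJ b)
    L (G * (mderiv i (e a) * u b)) *: (e a * u b).
  apply: eq_bigr => a Pa; rewrite {1}eE// mulr_sumr.
  by apply: eq_bigr => b _; rewrite scalerAr.
have -> : \sum_(b | PJ b) u b * coderiv i (u b) = \sum_(a | PI a) \sum_(b | PJ b)
    - L (G * (mderiv i (e a) * u b)) *: (e a * u b).
  rewrite exchange_big; apply: eq_bigr => b Pb; rewrite {1}uE// mulr_sumr.
  apply: eq_bigr => a _; rewrite -scalerAr mderiv_adjoint opprK.
  by rewrite [u b * _]mulrC [e a * coderiv _ _]mulrC.
rewrite -big_split big1// => a _; rewrite -big_split big1// => b _ /=.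
by rewrite scaleNr subrr.
Qed.

End ball_functional.

(** * Orthonormal bases, kernels and Christoffel functions *)

Section multi_index_layers.
Variable d : nat.

(** The type of multi-indices of degree k depends on a bound; its sums do not. *)
Lemma big_layer (V : nmodType) (F : multinom d -> V) k n : (k <= n)%N ->
  \sum_(b : bmultinom d n.+1 | mdeg b == k) F b =
  \sum_(b : bmultinom d k.+1 | mdeg b == k) F b.
Proof.
move=> kn; pose h (a : bmultinom d k.+1) : bmultinom d n.+1 := insubd bm0 (bmnm a).
pose h' (a : bmultinom d n.+1) : bmultinom d k.+1 := insubd bm0 (bmnm a).
have hE a : bmnm (h a) = bmnm a.
  by apply: insubdK; apply: leq_trans (bmdeg a) _; rewrite ltnS.
have h'E (a : bmultinom d n.+1) : mdeg a == k -> bmnm (h' a) = bmnm a.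
  by move=> /eqP ak; apply: insubdK; rewrite -topredE/= ak.
rewrite (reindex_onto h h') => [|a ak]; last first.
  by apply: val_inj; rewrite /= hE h'E.
apply: eq_big => [a|a _]; last by rewrite hE.
rewrite hE andb_idr// => ak; apply/eqP/val_inj => /=.
by rewrite h'E hE.
Qed.

Lemma big_layers (V : nmodType) (F : multinom d -> V) n :
  \sum_(b : bmultinom d n.+1) F b =
  \sum_(k < n.+1) \sum_(b : bmultinom d k.+1 | mdeg b == k) F b.
Proof.
rewrite (partition_big (fun b => Ordinal (bmdeg b)) xpredT)//=.
apply: eq_bigr => k _; rewrite -(big_layer F (ltn_ord k : (k <= n)%N)).
by apply: eq_bigl => b; rewrite -val_eqE.
Qed.

End multi_index_layers.

(** A multi-index of degree k is an ordered partition of k into d + 1 parts,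
    some of which may be zero. *)
Lemma card_layer d k :
  #|[pred b : bmultinom d.+1 k.+1 | mdeg b == k]| = 'C(d + k, d).
Proof.
rewrite -card_ord_partitions.
pose f (b : bmultinom d.+1 k.+1) : d.+1.-tuple 'I_k.+1 :=
  [tuple inord (bmnm b i) | i < d.+1].
pose m (t : d.+1.-tuple 'I_k.+1) := Multinom [tuple (tnth t i : nat) | i < d.+1].
have deg_m t : mdeg (m t) = (\sum_(i <- t) i)%N.
  by rewrite mdegE big_tuple; apply: eq_bigr => i _; rewrite mnmE.
have fK (b : bmultinom d.+1 k.+1) : m (f b) = bmnm b.
  apply/mnmP => i; rewrite mnmE tnth_mktuple inordK//.
  by apply: leq_ltn_trans (bmdeg b); rewrite mdegE (bigD1 i)//= leq_addr.
rewrite -(@card_in_imset _ _ f [pred b | mdeg (bmnm b) == k]); last first.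
  by move=> b c _ _ bc; apply: val_inj; rewrite /= -!fK bc.
apply: eq_card => t; rewrite inE; apply/imsetP/idP => [[b]|].
  by rewrite inE -fK deg_m => bk ->.
rewrite -deg_m => tk.
have mt : (mdeg (m t) < k.+1)%N by rewrite (eqP tk).
exists (BMultinom mt) => //; apply: eq_from_tnth => i; apply: val_inj.
by rewrite tnth_mktuple/= mnmE inord_val.
Qed.

Section orthogonal_polynomials.
Variables (R : realType) (d : nat) (nu : {measure set (d.-tuple R) -> \bar R}).
Implicit Types p q f h : mpoly d R.
Local Notation msize := (mmeasure (@mdeg d)).
Local Notation ip := (poly_inner nu).
Hypothesis ipP : is_inner_product ip.

(** The degree cannot drop without p being orthogonal to itself. *)
Lemma orth_spaceP m p : (msize p <= m.+1)%N ->
  (forall q, (msize q <= m)%N -> ip p q = 0) -> orth_space nu m p.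
Proof.
move=> pm pq; split => //; move: pm; rewrite leq_eqVlt => /orP[/eqP|pm]; first by right.
by left; apply: (ip_eq0 ipP); exact: pq.
Qed.

Lemma orth_space_size m p : orth_space nu m p -> (msize p <= m.+1)%N.
Proof. by case=> -[->|->//] _; rewrite mmeasure0. Qed.

Lemma orthonormal_basis_exists m : exists P, orthonormal_basis nu m P.
Proof.
have [e [e_orth e_span e_deg]] := graded_orthonormal_family ipP m.+1.
have eV a : mdeg a = m -> orth_space nu m (e a).
  move=> am; apply: orth_spaceP => [|q qm].
    by rewrite -[in X in (_ <= X)%N]am e_deg ?am.
  rewrite (e_span _ _ (leqnSn m) qm) (ip_sumr ipP) big1// => b _.
  rewrite (ipZr ipP) e_orth ?am ?(leq_trans (bmdeg b))//.
  case: eqP => [ab|_]; last by rewrite mulr0.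
  by have := bmdeg b; rewrite -ab am ltnn.
exists e; split => [//|a b am bm|p pV].
  by rewrite e_orth ?am ?bm.
exists (fun a => ip p (e a)).
rewrite {1}(e_span _ _ (leqnn _) (orth_space_size pV)).
rewrite (bigID (fun b : bmultinom d m.+1 => mdeg b == m))/=.
rewrite [X in _ + X]big1 ?addr0// => b bm; case: pV => _ ->; first by rewrite scale0r.
have bm' : (mdeg b < m)%N by rewrite ltn_neqAle bm -ltnS bmdeg.
by apply: leq_trans (e_deg _ _) _ => //; exact: bmdeg.
Qed.

Lemma orthonormal_basis_expand m P p : orthonormal_basis nu m P ->
  orth_space nu m p ->
  p = \sum_(a : bmultinom d m.+1 | mdeg a == m) ip p (P a) *: P a.
Proof.
move=> [PV P_orth P_span] /P_span[c pE]; rewrite [LHS]pE; apply: eq_bigr => a /eqP am.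
congr (_ *: _); rewrite pE (ip_suml ipP) (bigD1 a) ?am//= (ipZl ipP) P_orth//.
rewrite eqxx mulr1 big1 ?addr0// => b /andP[/eqP bm ba].
rewrite (ipZl ipP) P_orth//; move: ba; rewrite -val_eqE/= => /negPf ->.
by rewrite mulr0.
Qed.

Definition orth_basis m := xget (fun=> 0) [set P | orthonormal_basis nu m P].

Lemma orth_basisP m : orthonormal_basis nu m (orth_basis m).
Proof.
by have [P] := orthonormal_basis_exists m; exact: (@xgetI _ _ _ P).
Qed.

Lemma rkernelE (m : nat) x y : rkernel nu m x y =
  \sum_(a : bmultinom d m.+1 | mdeg a == m)
    peval (orth_basis m a) x * peval (orth_basis m a) y.
Proof. by []. Qed.

(** The bases of all the V_m of nu, gathered in one family. *)
Definition orth_family (a : multinom d) := orth_basis (mdeg a) a.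

Lemma orth_familyV a : orth_space nu (mdeg a) (orth_family a).
Proof. by have [h _ _] := orth_basisP (mdeg a); exact: h. Qed.

Lemma orth_family_orthonormal a b :
  ip (orth_family a) (orth_family b) = (a == b)%:R.
Proof.
wlog ab : a b / (mdeg a <= mdeg b)%N => [wl|].
  have [/wl//|/ltnW/wl] := leqP (mdeg a) (mdeg b).
  by rewrite (ipC ipP) eq_sym.
move: ab; rewrite leq_eqVlt => /orP[/eqP ab|ab].
  have [_ h _] := orth_basisP (mdeg b).
  by rewrite /orth_family ab h.
have /negPf -> : a != b by apply: contraTneq ab => ->; rewrite ltnn.
rewrite (ipC ipP); case: (orth_familyV b) => _ ->//.
exact: leq_trans (orth_space_size (orth_familyV a)) ab.
Qed.

End orthogonal_polynomials.

Section christoffel_kernel.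
Variables (R : realType) (d : nat) (nu : {measure set (d.-tuple R) -> \bar R}).
Implicit Types p q f h : mpoly d R.
Local Notation msize := (mmeasure (@mdeg d)).
Local Notation ip := (poly_inner nu).
Hypothesis ipP : is_inner_product ip.
Local Notation P := (orth_family nu).

(** The residue r of p is orthogonal to the whole family.  In a second
    orthonormal family e, adapted to the degree, each e_b lies in some V_k, which is
    spanned by the first family: so r is orthogonal to each e_b as well, and the e_b
    span all polynomials of degree at most n. *)
Lemma orth_family_expand n p : (msize p <= n.+1)%N ->
  p = \sum_(b : bmultinom d n.+1) ip p (P b) *: P b.
Proof.
move=> pn; apply/eqP; rewrite -subr_eq0; apply/eqP; set r := _ - _.
have r_orth a : (mdeg a <= n)%N -> ip r (P a) = 0.
  move=> an; rewrite /r (ipBl ipP) (ip_suml ipP).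
  rewrite (bigD1 (BMultinom (an : (mdeg a < n.+1)%N)))//= (ipZl ipP).
  rewrite (orth_family_orthonormal ipP) eqxx mulr1 big1 ?addr0 ?subrr// => b ba.
  rewrite (ipZl ipP) (orth_family_orthonormal ipP).
  by move: ba; rewrite -val_eqE/= => /negPf ->; rewrite mulr0.
have [e [e_orth e_span e_deg]] := graded_orthonormal_family ipP n.+1.
have rn : (msize r <= n.+1)%N.
  apply: leq_trans (mmeasureD_le _ _ _) _; rewrite geq_max pn/= mmeasureN.
  apply: leq_trans (mmeasure_sum _ _ _ _) _.
  apply/bigmax_leqP => b _; apply: leq_trans (mmeasureZ_le _ _ _) _.
  by apply: leq_trans (orth_space_size (orth_familyV ipP b)) _; exact: bmdeg.
rewrite (e_span _ _ (leqnn _) rn) big1// => b _.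
have eV : orth_space nu (mdeg b) (e b).
  apply: (orth_spaceP ipP) => [|q qb]; first by rewrite e_deg ?bmdeg.
  rewrite (e_span _ _ (ltnW (bmdeg b)) qb) (ip_sumr ipP) big1// => c _.
  have cb := bmdeg c.
  rewrite (ipZr ipP) e_orth ?(ltn_trans cb) ?bmdeg//.
  by case: eqP => [E|]; [rewrite -E ltnn in cb|rewrite mulr0].
rewrite (orthonormal_basis_expand ipP (orth_basisP ipP _) eV) (ip_sumr ipP).
rewrite big1 ?scale0r// => a /eqP ab; rewrite (ipZr ipP).
have -> : orth_basis nu (mdeg b) a = P a by rewrite /orth_family ab.
by rewrite r_orth ?mulr0// ab -ltnS bmdeg.
Qed.

Lemma sum_rkernel n x y : \sum_(k < n.+1) rkernel nu k%:Z x y =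
  \sum_(b : bmultinom d n.+1) peval (P b) x * peval (P b) y.
Proof.
rewrite (big_layers (fun a => peval (P a) x * peval (P a) y)).
apply: eq_bigr => k _; rewrite rkernelE; apply: eq_bigr => a /eqP ak.
by rewrite /orth_family ak.
Qed.

(** With K = K_n(., x) the reproducing kernel and S = K(x) = |K|^2, the inequality
    0 <= |p - K / S|^2 reads 1 / S <= |p|^2 whenever p(x) = 1, with equality for
    p = K / S. *)
Lemma inv_christoffelE n x :
  inv_christoffel nu n%:Z x = \sum_(k < n.+1) rkernel nu k%:Z x x.
Proof.
rewrite sum_rkernel /=; set S := \sum_b _; rewrite -[RHS]invrK; congr (_^-1).
pose K := \sum_(b : bmultinom d n.+1) peval (P b) x *: P b.
have pevalZ a p : peval (a *: p) x = a * peval p x by exact: mevalZ.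
have peval_sum (I : finType) (F : I -> mpoly d R) :
    peval (\sum_i F i) x = \sum_i peval (F i) x by exact: raddf_sum.
have Kn : (msize K <= n.+1)%N.
  apply: leq_trans (mmeasure_sum _ _ _ _) _.
  apply/bigmax_leqP => b _; apply: leq_trans (mmeasureZ_le _ _ _) _.
  by apply: leq_trans (orth_space_size (orth_familyV ipP b)) _; exact: bmdeg.
have repr p : (msize p <= n.+1)%N -> ip p K = peval p x.
  move=> pn; rewrite {2}(orth_family_expand pn) peval_sum (ip_sumr ipP).
  by apply: eq_bigr => b _; rewrite (ipZr ipP) pevalZ mulrC.
have KS : peval K x = S.
  by rewrite peval_sum; apply: eq_bigr => b _; rewrite pevalZ.
have ipKK : ip K K = S by rewrite repr.
have one_n : (msize (1 : mpoly d R) <= n.+1)%N by rewrite mmeasure1.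
have peval1 : peval (1 : mpoly d R) x = 1 by exact: meval1.
have S_gt0 : 0 < S.
  rewrite lt0r -ipKK (ip_ge0 ipP) andbT; apply/eqP => /(ip_eq0 ipP) K0.
  by have := repr 1 one_n; rewrite K0 (ip0r ipP) peval1 => /eqP; rewrite eq_sym oner_eq0.
have sqE p : \int[nu]_x (peval p x ^+ 2) = ip p p.
  by rewrite /poly_inner; under eq_Rintegral do rewrite expr2.
have lbS p : (msize p <= n.+1)%N -> peval p x = 1 -> S^-1 <= ip p p.
  move=> pn px1; have := ip_ge0 ipP (p - S^-1 *: K).
  rewrite (ipBl ipP) !(ipBr ipP) !(ipZl ipP) !(ipZr ipP) (ipC ipP K) repr// px1.
  by rewrite ipKK mulVf ?gt_eqF// !mulr1 subrr subr0 subr_ge0.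
apply/eqP; rewrite eq_le; apply/andP; split.
  apply: ge_inf.
    by exists S^-1 => _ [p [pn px1] <-]; rewrite sqE; exact: lbS.
  exists (S^-1 *: K).
    split; first by apply: leq_trans (mmeasureZ_le _ _ _) _.
    by rewrite pevalZ KS mulVf ?gt_eqF.
  by rewrite sqE (ipZl ipP) (ipZr ipP) ipKK mulVf ?gt_eqF// mulr1.
apply: lb_le_inf; last by move=> _ [p [pn px1] <-]; rewrite sqE; exact: lbS.
by exists (\int[nu]_x (peval 1 x ^+ 2)), 1.
Qed.

End christoffel_kernel.

(** * The weight of the ball in dimension one *)

Section one_dim.
Variable R : realType.
Local Notation leb := (@lebesgue_measure R).

Lemma FTC2_derive (f F : R -> R) (a b : R) : a < b ->
  (forall x : R, x \in `[a, b]%R -> is_derive x (1 : R) F (f x)) ->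
  (forall x : R, x \in `[a, b]%R -> {for x, continuous f}) ->
  (\int[leb]_(x in `[a, b]) (f x)%:E = (F b - F a)%:E)%E.
Proof.
move=> ab Ff fc; rewrite EFinB; apply: (@continuous_FTC2 R f F a b ab).
- apply: continuous_in_subspaceT => x; rewrite inE/= => xab; exact: fc.
- have dF x : x \in `[a, b]%R -> derivable F x 1 by move=> /Ff; case.
  split.
  + by move=> x xab; apply: dF; apply: subset_itv_oo_cc xab.
  + apply: cvg_at_right_filter; apply: differentiable_continuous.
    by apply/derivable1_diffP; apply: dF; rewrite bound_itvE ltW.
  + apply: cvg_at_left_filter; apply: differentiable_continuous.
    by apply/derivable1_diffP; apply: dF; rewrite bound_itvE ltW.
- move=> x xab; rewrite derive1E.
  have xab' : x \in `[a, b]%R by apply: subset_itv_oo_cc xab.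
  exact: (@derive_val _ _ _ _ _ _ _ (Ff _ xab')).
Qed.

(** Since 0^-1 = 0 and the square root of a negative number is 0, this function
    is its own restriction to the open interval of radius sqrt c, and it is zero when
    c <= 0. *)
Definition arcsine_density (c t : R) : R := (Num.sqrt (c - t ^+ 2))^-1.
Local Notation w := arcsine_density.

(** The intervals [- cutoff r n, cutoff r n] exhaust the open interval of radius r,
    and keep away from its ends, where the arcsine density blows up. *)
Definition cutoff (r : R) (n : nat) : R := r * (1 - harmonic n.+1).

Lemma cutoff_cvg r : cutoff r n @[n --> \oo] --> r.
Proof.
rewrite -[X in _ --> X]mulr1; apply: cvgMr.
rewrite -[X in _ --> X]subr0; apply: cvgB; first exact: cvg_cst.
rewrite (cvg_shiftS (@harmonic R)); exact: cvg_harmonic.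
Qed.

Lemma cutoff_lt r n : 0 < r -> 0 < cutoff r n < r.
Proof.
move=> r0; rewrite /cutoff pmulr_rgt0// subr_gt0 invf_lt1 ?ltr1n//=.
by rewrite gtr_pMr// ltrBlDl ltrDr invr_gt0.
Qed.

Lemma cutoff_nd r : 0 < r -> nondecreasing_seq (cutoff r).
Proof.
move=> r0 m n mn; rewrite /cutoff ler_pM2l// lerB// lef_pV2 ?posrE//.
by rewrite ler_nat.
Qed.

Lemma radicand_gt0 (c t : R) : 0 < c -> t \in `]- Num.sqrt c, Num.sqrt c[%R ->
  0 < c - t ^+ 2.
Proof.
move=> c0; rewrite in_itv/= => /andP[t1 t2].
rewrite -[c in c - _]sqr_sqrtr ?ltW// subr_sqr.
by apply: mulr_gt0; lra.
Qed.

Lemma sqrt_radicand_out (c t : R) : t \notin `]- Num.sqrt c, Num.sqrt c[%R ->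
  Num.sqrt (c - t ^+ 2) = 0.
Proof.
move=> tc; apply/eqP; rewrite sqrtr_eq0 subr_le0 leNgt; apply: contra tc => tc.
have c0 : 0 < c := le_lt_trans (sqr_ge0 t) tc.
by rewrite in_itv/= -ltr_norml -(ltr_pXn2r (n := 2)) ?nnegrE// ?sqrtr_ge0//
   sqr_sqrtr ?ltW// real_normK ?num_real.
Qed.

Lemma cutoffU (r : R) : 0 < r ->
  \bigcup_n [set` `[- cutoff r n, cutoff r n]%R] = [set` `]- r, r[%R].
Proof.
move=> r0; apply/seteqP; split => [t [n _]|t] /=; rewrite !in_itv/= -ltr_norml.
  by rewrite -ler_norml => /le_lt_trans; apply; have /andP[] := cutoff_lt n r0.
move=> tr; have [N _ /(_ N (leqnn _)) /= tN] := cvgr_gt _ (@cutoff_cvg r) _ tr.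
by exists N => //=; rewrite in_itv/= -ler_norml ltW.
Qed.

Lemma measurable_inv_sqrt : measurable_fun setT (fun x : R => (Num.sqrt x)^-1).
Proof.
rewrite (_ : (fun _ => _) = (fun x => (Num.sqrt x) `^ (-1))); last first.
  by apply/funext => x; rewrite powR_inv1// sqrtr_ge0.
exact: (measurableT_comp (@measurable_powR R (-1)) measurable_sqrtr).
Qed.

Lemma measurable_horner (p : {poly R}) : measurable_fun setT (horner p).
Proof. exact: continuous_measurable_fun (@continuous_horner _ p). Qed.

Definition radicand (c : R) : {poly R} := c%:P - 'X^2.

Lemma radicandE c t : (radicand c).[t] = c - t ^+ 2.
Proof. by rewrite /radicand !hornerE. Qed.

Lemma measurable_arcsine_density c : measurable_fun setT (w c).
Proof.
rewrite (_ : w c = (fun x => (Num.sqrt x)^-1) \o horner (radicand c)).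
  exact: measurableT_comp measurable_inv_sqrt (measurable_horner _).
by apply/funext => t; rewrite /= radicandE.
Qed.

Lemma derive_asin_scaled (r t : R) : 0 < r -> - r < t < r ->
  is_derive t (1 : R) (fun x => asin (x / r)) (w (r ^+ 2) t).
Proof.
move=> r0 /andP[t1 t2].
have tr' : -1 < t / r < 1.
  by rewrite ltr_pdivlMr// ltr_pdivrMr// mulN1r mul1r t1.
have E x : (r^-1 *: 'X : {poly R}).[x] = x / r by rewrite !hornerE mulrC.
rewrite (_ : (fun x => _) = (@asin R) \o horner (r^-1 *: 'X)); last first.
  by apply/funext => x /=; rewrite E.
apply: is_derive_eq.
  by apply: is_derive1_comp; rewrite E; exact: is_derive1_asin.
rewrite derivZ derivX !hornerE /w.
have -> : 1 - (t / r) ^+ 2 = (r ^+ 2 - t ^+ 2) / r ^+ 2.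
  by field; rewrite gt_eqF.
rewrite sqrtrM; last first.
  rewrite subr_ge0 -[t ^+ 2]real_normK ?num_real//.
  by rewrite lerXn2r ?nnegrE ?(ltW r0)// ler_norml !ltW.
by rewrite sqrtrV ?sqr_ge0// sqrtr_sqr gtr0_norm// invfM invrK /= mulr1 mulfK ?gt_eqF.
Qed.

Lemma derive_sqrt_poly c (q : {poly R}) (t : R) : 0 < c - t ^+ 2 ->
  is_derive t (1 : R) (fun x => Num.sqrt (c - x ^+ 2) * q.[x])
    (Num.sqrt (c - t ^+ 2) * q^`().[t] - w c t * (t * q.[t])).
Proof.
move=> ct.
rewrite (_ : (fun x => _) = (Num.sqrt \o horner (radicand c)) * horner q); last first.
  by apply/funext => x; rewrite -radicandE.
have d1 : is_derive t (1 : R) (Num.sqrt \o horner (radicand c))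
    ((2 * Num.sqrt (c - t ^+ 2))^-1 * (radicand c)^`().[t]).
  have d0 : is_derive (radicand c).[t] (1 : R) Num.sqrt (2 * Num.sqrt (c - t ^+ 2))^-1.
    by rewrite radicandE; exact: is_derive1_sqrt.
  exact: (is_derive1_comp d0 (is_derive_poly _ _)).
apply: (is_derive_eq (is_deriveM d1 (is_derive_poly q t))).
rewrite /= radicandE /radicand derivB derivC derivXn !hornerE /w /GRing.scale/=.
rewrite invfM; field.
by rewrite gt_eqF// sqrtr_gt0.
Qed.

Lemma continuous_arcsine_density (c t : R) : 0 < c - t ^+ 2 -> {for t, continuous (w c)}.
Proof.
move=> ct; apply: cvgV; first by rewrite gt_eqF// sqrtr_gt0.
rewrite (_ : (fun x => _) = (Num.sqrt \o horner (radicand c))); last first.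
  by apply/funext => x; rewrite -radicandE.
rewrite -radicandE; apply: continuous_comp; first exact: continuous_horner.
exact: sqrt_continuous.
Qed.

Lemma integral_support (f : R -> R) (D : set R) :
  (forall x, ~ D x -> f x = 0) ->
  (\int[leb]_x (f x)%:E = \int[leb]_(x in D) (f x)%:E)%E.
Proof.
move=> f0; rewrite [RHS]integral_mkcond; apply: eq_integral => x _.
by rewrite patchE; case: ifPn => // /negP; rewrite inE => /f0 ->.
Qed.

Lemma cutoff_in (c : R) n t : 0 < c ->
  t \in `[- cutoff (Num.sqrt c) n, cutoff (Num.sqrt c) n]%R -> 0 < c - t ^+ 2.
Proof.
move=> c0 ta; apply: radicand_gt0 => //.
have r0 : 0 < Num.sqrt c by rewrite sqrtr_gt0.
have : (\bigcup_n [set` `[- cutoff (Num.sqrt c) n, cutoff (Num.sqrt c) n]%R]) t by exists n.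
by rewrite cutoffU.
Qed.

Lemma sqrt_radicand_le0 (c t : R) : c <= 0 -> Num.sqrt (c - t ^+ 2) = 0.
Proof.
move=> c0; apply/eqP; rewrite sqrtr_eq0 subr_le0.
exact: le_trans (sqr_ge0 t).
Qed.

(** The primitive asin(t / r) takes its values in [- pi / 2, pi / 2].  What matters
    for the induction on the dimension is that the bound is the same for all c. *)
Lemma integral_arcsine_density_le c : (\int[leb]_t (w c t)%:E <= pi%:E)%E.
Proof.
have [c0|c0] := leP c 0.
  rewrite integral0_eq ?lee_fin ?pi_ge0// => t _.
  by rewrite /w sqrt_radicand_le0// invr0.
set r := Num.sqrt c; have r0 : 0 < r by rewrite sqrtr_gt0.
rewrite (integral_support (D := [set` `]- r, r[%R])); last first.
  by move=> t /negP tr; rewrite /w sqrt_radicand_out// invr0.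
rewrite -cutoffU//.
have cvgI : (\int[leb]_(t in [set` `[- cutoff r n, cutoff r n]%R]) (w c t)%:E @[n --> \oo] -->
   \int[leb]_(t in \bigcup_n [set` `[- cutoff r n, cutoff r n]%R]) (w c t)%:E)%E.
  apply: ge0_nondecreasing_set_cvg_integral => //.
  - move=> m n mn; apply/subsetPset => t /=; rewrite !in_itv/= -!ler_norml => /le_trans; apply.
    exact: cutoff_nd.
  - by move=> n; apply: measurable_funTS; apply/measurable_EFinP; exact: measurable_arcsine_density.
  - by move=> n t _; rewrite lee_fin invr_ge0 sqrtr_ge0.
rewrite -(cvg_lim (@ereal_hausdorff R) cvgI).
apply: lime_le; first by apply/cvg_ex; eexists; exact: cvgI.
apply: nearW => n.
have /andP[a0 ar] := cutoff_lt n r0.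
have -> : (\int[leb]_(t in `[(- cutoff r n)%R, cutoff r n]) (w c t)%:E =
    (asin (cutoff r n / r) - asin (- cutoff r n / r))%:E)%E.
  apply: (FTC2_derive (F := fun t => asin (t / r))).
  - by rewrite gtrN.
  - move=> t; rewrite in_itv/= => /andP[t1 t2]; rewrite -[c in w c]sqr_sqrtr ?ltW//.
    apply: derive_asin_scaled => //; apply/andP; split.
      by rewrite (lt_le_trans _ t1) ?ltrN2.
    exact: le_lt_trans ar.
  - by move=> t /(cutoff_in c0) tc; exact: continuous_arcsine_density.
have ar1 : cutoff r n / r <= 1 by rewrite ler_pdivrMr// mul1r ltW.
have ar0 : 0 <= cutoff r n / r by rewrite divr_ge0 ?ltW.
rewrite lee_fin [leRHS]splitr lerD ?asin_lepi2//; first by rewrite ar1 andbT; lra.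
rewrite lerNl asin_geNpi2// mulNr lerN2 ar1/=; lra.
Qed.

Lemma integrable_arcsine_density c : leb.-integrable setT (EFin \o w c).
Proof.
apply/integrableP; split.
  by apply/measurable_EFinP; exact: measurable_arcsine_density.
under eq_integral do rewrite gee0_abs ?lee_fin ?invr_ge0 ?sqrtr_ge0//.
exact: le_lt_trans (integral_arcsine_density_le c) (ltry _).
Qed.

Lemma sqrt_divsqrt (r : R) : Num.sqrt r = r * (Num.sqrt r)^-1.
Proof.
have [r0|r0] := leP r 0.
  by have /eqP -> : Num.sqrt r == 0; rewrite ?sqrtr_eq0// invr0 mulr0.
by rewrite -{2}[r]sqr_sqrtr ?ltW// expr2 mulfK// gt_eqF// sqrtr_gt0.
Qed.

Lemma horner_bounded (q : {poly R}) (B : R) :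
  exists C, forall t, `|t| <= B -> `|q.[t]| <= C.
Proof.
elim/poly_ind: q => [|q a [C HC]].
  by exists 0 => t _; rewrite horner0 normr0.
exists (C * B + `|a|) => t tB; rewrite !hornerE.
apply: le_trans (ler_normD _ _) _; rewrite lerD2r normrM.
by rewrite ler_pM// ?HC.
Qed.

(** The integrand is the derivative of sqrt(c - t^2) q(t).  It may be infinite at the
    ends of the interval, hence the passage to the limit over the truncated
    intervals, dominated by a multiple of the arcsine density. *)
Lemma arcsine_by_parts c (q : {poly R}) :
  (\int[leb]_t (Num.sqrt (c - t ^+ 2) * q^`().[t] - w c t * (t * q.[t]))%:E = 0)%E.
Proof.
have [c0|c0] := leP c 0.
  apply: integral0_eq => t _.
  by rewrite /w sqrt_radicand_le0// invr0 !mul0r subrr.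
set r := Num.sqrt c; have r0 : 0 < r by rewrite sqrtr_gt0.
pose f t := Num.sqrt (c - t ^+ 2) * q^`().[t] - w c t * (t * q.[t]).
pose J n := [set` `[- cutoff r n, cutoff r n]%R].
pose p := radicand c * q^`() - 'X * q.
have fE t : f t = w c t * p.[t].
  by rewrite /f sqrt_divsqrt /p /w hornerD hornerN !hornerM radicandE hornerX; ring.
have [C HC] := horner_bounded p r.
have f0 t : t \notin `]- r, r[%R -> f t = 0.
  by move=> tr; rewrite fE /w sqrt_radicand_out// invr0 mul0r.
have w_ge0 t : 0 <= w c t by rewrite invr_ge0 sqrtr_ge0.
have f_le t : `|f t| <= `|C| * w c t.
  have [tr|/f0 ->] := boolP (t \in `]- r, r[%R); last by rewrite normr0 mulr_ge0.
  rewrite fE normrM mulrC (ger0_norm (w_ge0 t)) ler_wpM2r//; apply: le_trans (ler_norm _).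
  by apply: HC; move: tr; rewrite in_itv/= -ltr_norml => /ltW.
have mf : measurable_fun setT f.
  rewrite (_ : f = w c \* horner p); last exact/funext.
  by apply: measurable_funM; [exact: measurable_arcsine_density|exact: measurable_horner].
have mJ n : measurable (J n) by exact: measurable_itv.
have [] := @dominated_convergence _ _ R lebesgue_measure setT measurableT
  (fun n => (EFin \o f) \_ (J n)) (EFin \o f) (EFin \o (fun t => `|C| * w c t)).
- move=> n; apply/(measurable_restrictT (EFin \o f)) => //.
  by apply: measurable_funTS; apply/measurable_EFinP.
- exact/measurable_EFinP.
- apply: aeW => t _; have [tr|tr] := boolP (t \in `]- r, r[%R); last first.
    rewrite (_ : (fun n => _) = cst (f t)%:E); first exact: cvg_cst.
    by apply/funext => n; rewrite patchE /= (f0 _ tr); case: ifP.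
  apply: cvg_near_cst.
  move: tr; rewrite in_itv/= -ltr_norml => tr.
  near=> n; rewrite patchE ifT// inE /J/= in_itv/= -ler_norml ltW//.
  by near: n; exact: (cvgr_gt _ (@cutoff_cvg r)).
- rewrite (_ : EFin \o _ = (fun t => `|C|%:E * (w c t)%:E)%E)//.
  by apply: integrableZl => //; exact: integrable_arcsine_density.
- by apply: aeW => t n _; rewrite patchE; case: ifPn => _; rewrite /= lee_fin ?normr0 ?mulr_ge0.
move=> _ _ cvgf.
(* the boundary terms at the truncation a add up to sqrt(c - a^2) (q(a) - q(-a)) *)
pose q' : {poly R} := q - (q \Po (- 'X)).
have q'E t : q'.[t] = q.[t] - q.[- t].
  by rewrite /q' hornerD hornerN horner_comp hornerN hornerX.
have intJ n : (\int[leb]_x ((EFin \o f) \_ (J n)) x =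
    (Num.sqrt (radicand c).[cutoff r n] * q'.[cutoff r n])%:E)%E.
  have /andP[a0 ar] := cutoff_lt n r0.
  rewrite -integral_mkcond.
  have -> : (\int[leb]_(x in J n) (EFin \o f) x =
     (Num.sqrt (c - (cutoff r n) ^+ 2) * q.[cutoff r n] -
      Num.sqrt (c - (- cutoff r n) ^+ 2) * q.[- cutoff r n])%:E)%E.
    apply: (FTC2_derive (F := fun t => Num.sqrt (c - t ^+ 2) * q.[t])).
    - by rewrite gtrN.
    - by move=> t /(cutoff_in c0) tc; exact: derive_sqrt_poly.
    - move=> t /(cutoff_in c0) tc; rewrite (_ : f = w c \* horner p); last exact/funext.
      apply: cvgM; first exact: continuous_arcsine_density.
      exact: continuous_horner.
  by rewrite sqrrN q'E radicandE mulrBr.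
have cvg0 : (\int[leb]_x ((EFin \o f) \_ (J n)) x @[n --> \oo] --> 0)%E.
  under eq_fun do rewrite intJ.
  apply/fine_cvgP; split; first exact: nearW.
  rewrite (_ : fine \o _ = (fun t => Num.sqrt (radicand c).[t] * q'.[t]) \o cutoff r)//.
  rewrite (_ : 0 = Num.sqrt (radicand c).[r] * q'.[r]); last first.
    by rewrite radicandE sqr_sqrtr ?ltW// subrr sqrtr0 mul0r.
  apply: (cvg_comp _ _ (@cutoff_cvg r)).
  apply: cvgM; last exact: continuous_horner.
  by apply: continuous_comp; [exact: continuous_horner|exact: sqrt_continuous].
exact: (cvg_unique (@ereal_hausdorff R) cvgf cvg0).
Unshelve. all: by end_near. Qed.

End one_dim.

(** * The weight of the ball in all dimensions *)

Section tuple_integral.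
Variable R : realType.
Local Notation leb := (@lebesgue_measure R).
Local Notation lebT d := (@lebesgue_tuple R d).

Lemma ge0_integral_tuple_prod d (f : d.+1.-tuple R -> \bar R) :
  measurable_fun setT f -> (forall x, 0 <= f x)%E ->
  (\int[lebT d.+1]_z f z = \int[(leb \x lebT d)%E]_z f (tuple_cons z))%E.
Proof.
move=> mf f0.
transitivity (\int[pushforward (leb \x lebT d)%E (@tuple_cons R d)]_z f z)%E => //.
rewrite ge0_integral_pushforward.
- by rewrite preimage_setT.
- exact: measurable_tuple_cons.
- by [].
- by [].
- by move=> y _.
Qed.

Lemma ge0_integral_tuple_cons d (f : d.+1.-tuple R -> \bar R) :
  measurable_fun setT f -> (forall x, 0 <= f x)%E ->
  (\int[lebT d.+1]_z f z =
   \int[lebT d]_x \int[leb]_t f (tuple_cons (t, x)))%E.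
Proof.
move=> mf f0; rewrite ge0_integral_tuple_prod//.
rewrite (@fubini_tonelli2 _ _ _ _ _ lebesgue_measure (lebT d) (f \o @tuple_cons R d))//.
  exact: measurableT_comp mf (@measurable_tuple_cons R d).
by move=> z; exact: f0.
Qed.

Lemma integrable_tuple_cons d (f : d.+1.-tuple R -> \bar R) :
  (lebT d.+1).-integrable setT f ->
  (leb \x lebT d)%E.-integrable setT (f \o @tuple_cons R d).
Proof.
move=> /integrableP[mf fi]; apply/integrableP; split.
  exact: measurableT_comp mf (@measurable_tuple_cons R d).
rewrite -(ge0_integral_tuple_prod (f := abse \o f))//.
  exact: measurableT_comp.
by move=> z; exact: abse_ge0.
Qed.

Lemma integral_tuple_prod d (f : d.+1.-tuple R -> \bar R) :
  (lebT d.+1).-integrable setT f ->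
  (\int[lebT d.+1]_z f z = \int[(leb \x lebT d)%E]_z f (tuple_cons z))%E.
Proof.
move=> fi; have fi' := integrable_tuple_cons fi; have /integrableP[mf _] := fi.
transitivity (\int[pushforward (leb \x lebT d)%E (@tuple_cons R d)]_z f z)%E => //.
rewrite integral_pushforward.
- by rewrite preimage_setT.
- exact: measurable_tuple_cons.
- by [].
- by rewrite preimage_setT.
- by [].
Qed.

Lemma integral_tuple_cons d (f : d.+1.-tuple R -> \bar R) :
  (lebT d.+1).-integrable setT f ->
  (\int[lebT d.+1]_z f z =
     \int[lebT d]_x \int[leb]_t f (tuple_cons (t, x)))%E /\
  (\int[lebT d.+1]_z f z =
     \int[leb]_t \int[lebT d]_x f (tuple_cons (t, x)))%E.
Proof.
move=> fi; have fi' := integrable_tuple_cons fi; rewrite integral_tuple_prod//.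
split; first exact/esym/(integral21_prod_meas1 fi').
exact/esym/(integral12_prod_meas1 fi').
Qed.

Definition sqnorm d (x : d.-tuple R) : R := \sum_(i < d) tnth x i ^+ 2.

(** As for the arcsine density, the weight vanishes outside the open ball of
    radius sqrt c. *)
Definition weight d (c : R) (x : d.-tuple R) : R := (Num.sqrt (c - sqnorm x))^-1.

(** Monomials are of this form, and fixing a coordinate preserves it, which is
    what Fubini needs. *)
Definition prod_poly d (F : 'I_d -> {poly R}) (x : d.-tuple R) : R :=
  \prod_(i < d) (F i).[tnth x i].

Lemma sqnorm_cons d t (x : d.-tuple R) :
  sqnorm (tuple_cons (t, x)) = t ^+ 2 + sqnorm x.
Proof.
rewrite /sqnorm big_ord_recl; congr (_ + _); apply: eq_bigr => i _.
by rewrite tnthS.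
Qed.

Lemma prod_poly_cons d (F : 'I_d.+1 -> {poly R}) t (x : d.-tuple R) :
  prod_poly F (tuple_cons (t, x)) =
  (F ord0).[t] * prod_poly (fun i => F (lift ord0 i)) x.
Proof.
rewrite /prod_poly big_ord_recl; congr (_ * _); apply: eq_bigr => i _.
by rewrite tnthS.
Qed.

Lemma weight_cons d c t (x : d.-tuple R) :
  weight c (tuple_cons (t, x)) = arcsine_density (c - sqnorm x) t.
Proof.
by rewrite /weight sqnorm_cons /arcsine_density opprD addrA addrAC.
Qed.

Lemma weight_consr d c t (x : d.-tuple R) :
  weight c (tuple_cons (t, x)) = weight (c - t ^+ 2) x.
Proof. by rewrite /weight sqnorm_cons opprD addrA. Qed.

Lemma weight_ge0 d c (x : d.-tuple R) : 0 <= weight c x.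
Proof. by rewrite invr_ge0 sqrtr_ge0. Qed.

Lemma sqnorm_ge0 d (x : d.-tuple R) : 0 <= sqnorm x.
Proof. by apply: sumr_ge0 => i _; exact: sqr_ge0. Qed.

Lemma measurable_sqnorm d : measurable_fun setT (@sqnorm d).
Proof.
apply: measurable_sum => i; apply: measurable_funX; exact: measurable_tnth.
Qed.

Lemma measurable_sqrt_sqnorm d c :
  measurable_fun setT (fun x : d.-tuple R => Num.sqrt (c - sqnorm x)).
Proof.
apply: (measurableT_comp measurable_sqrtr).
by apply: measurable_funB => //; exact: measurable_sqnorm.
Qed.

Lemma measurable_weight d c : measurable_fun setT (@weight d c).
Proof.
apply: (measurableT_comp (@measurable_inv_sqrt R)).
by apply: measurable_funB => //; exact: measurable_sqnorm.
Qed.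

Lemma measurable_prod_poly d (F : 'I_d -> {poly R}) :
  measurable_fun setT (prod_poly F).
Proof.
apply: measurable_prod => i _.
apply: (measurableT_comp (measurable_horner (F i))); exact: measurable_tnth.
Qed.

Lemma sqnorm_coord d (x : d.-tuple R) c i : sqnorm x < c -> `|tnth x i| <= 1 + `|c|.
Proof.
move=> xc; have : tnth x i ^+ 2 < c.
  apply: le_lt_trans xc; rewrite /sqnorm (bigD1 i)//= lerDl.
  by apply: sumr_ge0 => j _; exact: sqr_ge0.
rewrite -real_normK ?num_real// => xic; rewrite leNgt; apply/negP => h.
have c0 : 0 <= `|c| by []. have := ler_norm c; nra.
Qed.

Lemma weight_out d c (x : d.-tuple R) : c <= sqnorm x -> Num.sqrt (c - sqnorm x) = 0.
Proof. by move=> h; apply/eqP; rewrite sqrtr_eq0 subr_le0. Qed.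

Lemma sqrt_le_weight d c (x : d.-tuple R) :
  Num.sqrt (c - sqnorm x) <= `|c| * weight c x.
Proof.
have [h|h] := leP c (sqnorm x).
  by rewrite weight_out// mulr_ge0// weight_ge0.
have s0 : 0 < Num.sqrt (c - sqnorm x) by rewrite sqrtr_gt0 subr_gt0.
rewrite /weight ler_pdivlMr// -expr2 sqr_sqrtr; last by rewrite subr_ge0 ltW.
by apply: le_trans (ler_norm c); rewrite gerBl sqnorm_ge0.
Qed.

Lemma prod_poly_bounded d (F : 'I_d -> {poly R}) (c : R) :
  exists2 C, 0 <= C & forall x, sqnorm x < c -> `|prod_poly F x| <= C.
Proof.
have /choice[C HC] : forall i, exists C, forall t, `|t| <= 1 + `|c| -> `|(F i).[t]| <= C.
  by move=> i; exact: horner_bounded.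
have HC0 i : 0 <= C i.
  by apply: le_trans (HC i 0 _); rewrite ?normr0// addr_ge0.
exists (\prod_i C i) => [|x xc]; first exact: prodr_ge0.
rewrite normr_prod; apply: ler_prod => i _; rewrite normr_ge0/=.
by apply: HC; exact: sqnorm_coord.
Qed.

(** The integral over the first coordinate is at most pi, and it is zero when the
    other coordinates are outside a box. *)
Lemma integral_weight_lty d c : (\int[lebT d]_x (weight c x)%:E < +oo)%E.
Proof.
case: d => [|d].
  rewrite integral_dirac//; first by rewrite diracT mul1e ltry.
  by apply/measurable_EFinP; exact: measurable_weight.
rewrite ge0_integral_tuple_cons; last 2 first.
- by apply/measurable_EFinP; exact: measurable_weight.
- by move=> x; rewrite lee_fin weight_ge0.
pose B : set (d.-tuple R) :=
  [set x | forall i, `[- (1 + `|c|), 1 + `|c|]%classic (tnth x i)].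
have mB : measurable B.
  rewrite (_ : B = \bigcap_(i in [set: 'I_d])
      ((@tnth d R ^~ i) @^-1` `[- (1 + `|c|), 1 + `|c|]%classic)).
    apply: fin_bigcap_measurable => // i _.
    by rewrite -[X in measurable X]setTI; exact: measurable_tnth.
  by apply/seteqP; split => [x + i _|x + i] /=; apply.
apply: (@le_lt_trans _ _ (\int[lebT d]_x (pi%:E * (\1_B x)%:E)%E)%E).
  apply: ge0_le_integral => //.
  - by move=> x _; apply: integral_ge0 => t _; rewrite lee_fin weight_ge0.
  - apply: (@measurable_fun_fubini_tonelli_G _ _ _ _ _ lebesgue_measure
      (EFin \o @weight d.+1 c \o @tuple_cons R d)).
      apply: measurableT_comp (@measurable_tuple_cons R d).
      by apply/measurable_EFinP; exact: measurable_weight.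
    by move=> z; rewrite lee_fin weight_ge0.
  - by apply: measurable_funeM; apply/measurable_EFinP; exact: measurable_indic.
  - move=> x _; rewrite indicE; have [xB|xB] := boolP (x \in B).
      rewrite mule1; under eq_integral do rewrite weight_cons.
      exact: integral_arcsine_density_le.
    rewrite mule0 integral0_eq// => t _.
    rewrite weight_cons /arcsine_density sqrt_radicand_le0 ?invr0//.
    rewrite subr_le0 leNgt; apply: contra xB => xc; rewrite inE => i /=.
    by rewrite in_itv/= -ler_norml; exact: sqnorm_coord.
rewrite ge0_integralZl//; last by rewrite lee_fin pi_ge0.
  2: by apply/measurable_EFinP; exact: measurable_indic.
rewrite integral_indic// setIT.
rewrite [X in (_ * X)%E](_ : _ = \prod_(i < d)
    lebesgue_measure `[(- (1 + `|c|))%R, (1 + `|c|)%R]%classic)%E; last first.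
  by apply: (lebesgue_tuple_box (A := fun=> _)) => i; exact: measurable_itv.
apply: lte_mul_pinfty => //; first by rewrite lee_fin pi_ge0.
suff /andP[] : (0 <= \prod_(i < d)
    lebesgue_measure `[(- (1 + `|c|))%R, (1 + `|c|)%R]%classic < +oo)%E by [].
apply: (big_ind (fun u : \bar R => 0 <= u < +oo)%E) => [|u v /andP[u0 uy] /andP[v0 vy]|i _].
- by rewrite lee01 ltry.
- by rewrite mule_ge0//= lte_mul_pinfty// ge0_fin_numE.
- by rewrite measure_ge0 lebesgue_measure_itv/=; case: ifP => //; rewrite ltry.
Qed.

Lemma integrable_weight d c : (lebT d).-integrable setT (EFin \o @weight d c).
Proof.
apply/integrableP; split.
  by apply/measurable_EFinP; exact: measurable_weight.
under eq_integral do rewrite gee0_abs ?lee_fin ?weight_ge0//.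
exact: integral_weight_lty.
Qed.

Lemma integrable_le_weight d c (f : d.-tuple R -> R) C :
  measurable_fun setT f -> (forall x, `|f x| <= C * weight c x) ->
  (lebT d).-integrable setT (EFin \o f).
Proof.
move=> mf fC.
apply: (@le_integrable _ _ _ (lebT d) setT measurableT _
  (fun x => C%:E * (weight c x)%:E)%E); first exact/measurable_EFinP.
  move=> x _; rewrite -EFinM /= lee_fin; apply: le_trans (fC x) _; exact: ler_norm.
by apply: integrableZl => //; exact: integrable_weight.
Qed.

Lemma integrable_weight_poly d c (F : 'I_d -> {poly R}) :
  (lebT d).-integrable setT (fun x => (weight c x * prod_poly F x)%:E).
Proof.
have [C C0 HC] := prod_poly_bounded F c.
apply: (@integrable_le_weight _ c _ C).
  by apply: measurable_funM; [exact: measurable_weight|exact: measurable_prod_poly].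
move=> x; have [h|h] := leP c (sqnorm x).
  by rewrite /weight weight_out// invr0 mul0r mulr0 normr0.
by rewrite normrM mulrC (ger0_norm (weight_ge0 c x)) ler_wpM2r ?weight_ge0// HC.
Qed.

Lemma integrable_sqrt_poly d c (F : 'I_d -> {poly R}) :
  (lebT d).-integrable setT
    (fun x => (Num.sqrt (c - sqnorm x) * prod_poly F x)%:E).
Proof.
have [C C0 HC] := prod_poly_bounded F c.
apply: (@integrable_le_weight _ c _ (`|c| * C)).
  by apply: measurable_funM; [exact: measurable_sqrt_sqnorm|exact: measurable_prod_poly].
move=> x; have [h|h] := leP c (sqnorm x).
  by rewrite weight_out// mul0r normr0 mulr_ge0 ?weight_ge0// mulr_ge0.
rewrite normrM ger0_norm ?sqrtr_ge0// mulrAC ler_pM ?sqrtr_ge0//.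
  exact: sqrt_le_weight.
exact: HC.
Qed.

Definition subst_factor d (F : 'I_d -> {poly R}) i (q : {poly R}) j :=
  if j == i then q else F j.

(** If i is the first coordinate, integrate over it first.  Otherwise integrate
    first over the other coordinates: for a fixed value t of the first one, this is the
    statement in one dimension less, with c - t^2 instead of c.  The scalar a absorbs the
    factors that do not depend on the variables of integration. *)
Lemma weight_by_parts d (a c : R) (F : 'I_d -> {poly R}) i :
  (\int[lebT d]_x (a * (Num.sqrt (c - sqnorm x) * prod_poly (subst_factor F i (F i)^`()) x
     - weight c x * prod_poly (subst_factor F i ('X * F i)) x))%:E = 0)%E.
Proof.
elim: d a c F i => [a c F []//|d IHd a c F i].
set f := (X in (\int[_]_x X x)%E).
have fi : (lebT d.+1).-integrable setT f.
  rewrite /f (_ : (fun _ => _) = (fun x => a%:E *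
    ((Num.sqrt (c - sqnorm x) * prod_poly (subst_factor F i (F i)^`()) x)%:E
     - (weight c x * prod_poly (subst_factor F i ('X * F i)) x)%:E))%E)//.
  apply: integrableZl => //; apply: integrableB => //.
    exact: integrable_sqrt_poly.
  exact: integrable_weight_poly.
have [E1 E2] := integral_tuple_cons fi.
case: (unliftP ord0 i) => [j|] iE.
  rewrite E2 integral0_eq// => t _.
  rewrite -[RHS](IHd (a * (F ord0).[t]) (c - t ^+ 2) (fun k => F (lift ord0 k)) j).
  apply: eq_integral => x _; rewrite /f; congr (_%:E).
  rewrite sqnorm_cons !prod_poly_cons weight_consr opprD addrA.
  have U k q : subst_factor F i q (lift ord0 k) = subst_factor (fun k => F (lift ord0 k)) j q k.
    by rewrite /subst_factor iE (inj_eq lift_inj).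
  have U0 q : subst_factor F i q ord0 = F ord0 by rewrite /subst_factor iE.
  rewrite !U0.
  have P q : prod_poly (fun k => subst_factor F i q (lift ord0 k)) x =
      prod_poly (subst_factor (fun k => F (lift ord0 k)) j q) x.
    by apply: eq_bigr => k _; rewrite U.
  by rewrite !P iE; ring.
rewrite E1 integral0_eq// => x _.
have U k q : subst_factor F i q (lift ord0 k) = F (lift ord0 k) by rewrite /subst_factor iE.
have U0 q : subst_factor F i q ord0 = q by rewrite /subst_factor iE eqxx.
have P q : prod_poly (fun k => subst_factor F i q (lift ord0 k)) x =
    prod_poly (fun k => F (lift ord0 k)) x.
  by apply: eq_bigr => k _; rewrite U.
set b := prod_poly (fun k => F (lift ord0 k)) x in P.
rewrite -[RHS](arcsine_by_parts (c - sqnorm x) ((a * b) *: F ord0)).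
apply: eq_integral => t _; rewrite /f; congr (_%:E).
rewrite sqnorm_cons !prod_poly_cons weight_cons opprD addrA addrAC !P !U0 iE.
rewrite derivZ !hornerZ hornerM hornerX; ring.
Qed.

End tuple_integral.

(** * Integration against a density *)

Section density.
Context {disp : measure_display} {T : measurableType disp} {R : realType}.
Variables (m1 m2 : {measure set T -> \bar R}) (g : T -> R).
Hypotheses (mg : measurable_fun setT g) (g0 : forall x, 0 <= g x).
Hypothesis m1E : forall A, measurable A -> (m1 A = \int[m2]_(x in A) (g x)%:E)%E.
Import HBNNSimple.

Let integral_density_indic (A : set T) (k : R) : measurable A -> 0 <= k ->
  (\int[m1]_x (k * \1_A x)%:E = \int[m2]_x ((k * \1_A x) * g x)%:E)%E.
Proof.
move=> mA k0; under eq_integral do rewrite EFinM.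
under [RHS]eq_integral do rewrite -mulrA EFinM.
have mgA : measurable_fun setT (fun x => (\1_A x * g x)%:E).
  by apply/measurable_EFinP; apply: measurable_funM => //; exact: measurable_indic.
have gA0 x : (0 <= (\1_A x * g x)%:E)%E by rewrite lee_fin mulr_ge0.
have mA' : measurable_fun setT (fun x => (\1_A x : R)%:E).
  by apply/measurable_EFinP; exact: measurable_indic.
rewrite ge0_integralZl//= ge0_integralZl//.
congr (_ * _)%E; rewrite integral_indic// setIT m1E// integral_mkcond.
apply: eq_integral => x _; rewrite patchE indicE.
by case: ifP; rewrite ?mul1r ?mul0r.
Qed.

Let integral_density_nnsfun (h : {nnsfun T >-> R}) :
  (\int[m1]_x (h x)%:E = \int[m2]_x (h x * g x)%:E)%E.
Proof.
have hE x : h x = \sum_(y <- fset_set (range h)) `|y| * \1_(h @^-1` [set y]) x.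
  rewrite {1}fimfunE fsbig_finite//= big_seq [RHS]big_seq; apply: eq_bigr => y.
  by rewrite in_fset_set// inE => -[z _ <-]; rewrite ger0_norm.
have mh y : measurable_fun setT (fun x => `|y| * \1_(h @^-1` [set y]) x : R).
  by apply: measurable_funM => //; exact: measurable_indic.
under eq_integral do rewrite hE -sumEFin.
under [RHS]eq_integral do rewrite hE mulr_suml -sumEFin.
rewrite ge0_integral_sum//; last by move=> y; exact/measurable_EFinP.
rewrite ge0_integral_sum; first last.
- by move=> y x _; rewrite lee_fin !mulr_ge0.
- by move=> y; apply/measurable_EFinP; exact: measurable_funM.
- by [].
by apply: eq_bigr => y _; rewrite integral_density_indic.
Qed.

(** By definition of m1 for indicator functions, then by linearity for simple
    functions, and by monotone convergence. *)
Lemma ge0_integral_density (f : T -> \bar R) : measurable_fun setT f ->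
  (forall x, 0 <= f x)%E ->
  (\int[m1]_x f x = \int[m2]_x (f x * (g x)%:E))%E.
Proof.
move=> mf f0; pose f_ := nnsfun_approx measurableT mf.
have f_nd x : {homo (fun n => (f_ n x)%:E) : a b / (a <= b)%N >-> (a <= b)%E}.
  by move=> a b ab; rewrite lee_fin; exact/lefP/nd_nnsfun_approx.
have f_cvg x : (f_ n x)%:E @[n --> \oo] --> f x by exact: cvg_nnsfun_approx.
transitivity (limn (fun n => \int[m1]_x (f_ n x)%:E)%E).
  rewrite -monotone_convergence//.
  - by apply: eq_integral => x _; apply/esym/cvg_lim.
  - by move=> n; apply/measurable_EFinP.
  - by move=> n x _; rewrite lee_fin.
transitivity (limn (fun n => \int[m2]_x (f_ n x * g x)%:E)%E).
  by congr (limn _); apply/funext => n; exact: integral_density_nnsfun.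
rewrite -monotone_convergence//.
- apply: eq_integral => x _; apply/cvg_lim => //.
  by under eq_fun do rewrite EFinM; apply: cvgeZr.
- by move=> n; apply/measurable_EFinP; exact: measurable_funM.
- by move=> n x _; rewrite lee_fin mulr_ge0.
- by move=> x _ a b ab; rewrite lee_fin ler_wpM2r// -lee_fin f_nd.
Qed.

Lemma integral_density (f : T -> R) : measurable_fun setT f ->
  (\int[m1]_x (f x)%:E = \int[m2]_x (f x * g x)%:E)%E.
Proof.
move=> mf; rewrite integralE [RHS]integralE; congr (_ - _)%E.
  rewrite ge0_integral_density//; last exact/measurable_funepos/measurable_EFinP.
  apply: eq_integral => x _.
  by rewrite !funeposE -!EFin_max -EFinM maxr_pMl// mul0r.
rewrite ge0_integral_density//; last exact/measurable_funeneg/measurable_EFinP.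
apply: eq_integral => x _.
by rewrite !funenegE -!EFinN -!EFin_max -EFinM maxr_pMl// mul0r mulNr.
Qed.

Lemma integrable_density (f : T -> R) : measurable_fun setT f ->
  m2.-integrable setT (fun x => (f x * g x)%:E) ->
  m1.-integrable setT (EFin \o f).
Proof.
move=> mf /integrableP[_ h]; apply/integrableP; split; first exact/measurable_EFinP.
rewrite ge0_integral_density//; last by apply: measurableT_comp => //; apply/measurable_EFinP.
move: h; congr (_ < _)%E; apply: eq_integral => x _.
by rewrite -EFinM/= normrM (ger0_norm (g0 x)).
Qed.

End density.

(** * The equilibrium measure as a positive functional *)

Section link.
Variables (R : realType) (d : nat).
Local Notation lebT := (@lebesgue_tuple R d).
Local Notation G := (ball_mpoly R d).
Implicit Types (x : d.-tuple R) (p q : mpoly d R).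
Local Notation W := (@weight R d 1).
Local Notation mu := (equilibrium d : {measure set (d.-tuple R) -> \bar R}).
Local Notation gmu := (ball_poly_equilibrium d : {measure set (d.-tuple R) -> \bar R}).

Lemma peval_ball x : peval G x = ball_poly x.
Proof.
rewrite /peval /ball_mpoly mevalB meval1 /ball_poly /enorm sqr_sqrtr ?sumr_ge0//.
  congr (_ - _); rewrite raddf_sum; apply: eq_bigr => i _ /=.
  by rewrite rmorphXn /= mevalXU.
by move=> i _; exact: sqr_ge0.
Qed.

Lemma ball_polyE x : ball_poly x = 1 - sqnorm x.
Proof. by rewrite /ball_poly /enorm sqr_sqrtr// sqnorm_ge0. Qed.

Lemma ball_weightE x : ball_weight x = W x.
Proof. by rewrite /ball_weight ball_polyE. Qed.

Lemma weight_outside x : ~ unit_ball x -> W x = 0.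
Proof.
rewrite /unit_ball/= ball_polyE => /negP; rewrite -ltNge subr_lt0 => h.
by rewrite /weight weight_out ?invr0// ltW.
Qed.

Definition weight_mass : R := fine (\int[lebT]_x (W x)%:E).

Lemma ball_weight_measureE (A : set (d.-tuple R)) : measurable A ->
  (ball_weight_measure d A = \int[lebT]_(x in A) (W x)%:E)%E.
Proof.
move=> mA; rewrite /ball_weight_measure /= /mdensity.
rewrite integral_mkcondr; apply: eq_integral => x _; rewrite patchE.
rewrite ball_weightE; case: ifPn => // /negP; rewrite inE => /weight_outside ->.
by [].
Qed.

(** The weight is at least 1 on a small box.  A zero mass would turn the
    normalized measure into the default Dirac measure. *)
Lemma weight_mass_gt0 : 0 < weight_mass.
Proof.
(* the box of half-side b lies in the open ball because d b^2 < 1 *)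
pose b : R := d.+1%:R^-1.
pose B : set (d.-tuple R) := [set x | forall i, `[- b, b]%classic (tnth x i)].
have b0 : 0 < b by rewrite invr_gt0 ltr0n.
have mB : measurable B.
  rewrite (_ : B = \bigcap_(i in [set: 'I_d])
      ((@tnth d R ^~ i) @^-1` `[- b, b]%classic)).
    apply: fin_bigcap_measurable => // i _.
    by rewrite -[X in measurable X]setTI; exact: measurable_tnth.
  by apply/seteqP; split => [x + i _|x + i] /=; apply.
have lB : (0 < lebT B)%E.
  rewrite (_ : lebT B = \prod_(i < d) lebesgue_measure `[(- b)%R, b]%classic)%E; last first.
    by apply: (lebesgue_tuple_box (A := fun=> _)) => i; exact: measurable_itv.
  apply: (big_ind (fun u : \bar R => 0 < u)%E) => // [u v u0 v0|i _].
    exact: mule_gt0.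
  rewrite lebesgue_measure_itv/= lte_fin gtrN// -EFinD lte_fin; lra.
have W1 x : B x -> 1 <= W x.
  move=> xB.
  have x1 : sqnorm x < 1.
    apply: (@le_lt_trans _ _ (\sum_(i < d) b ^+ 2)).
      apply: ler_sum => i _; rewrite -real_normK ?num_real//.
      rewrite lerXn2r ?nnegrE ?(ltW b0)// ler_norml.
      by have := xB i; rewrite /= in_itv.
    rewrite sumr_const card_ord -mulr_natr.
    have bd : b * d%:R = 1 - b.
      by have : b * d.+1%:R = 1 by [rewrite mulVf// pnatr_eq0]; rewrite -natr1; lra.
    have b1 : 0 <= b * d%:R by rewrite mulr_ge0// ltW.
    rewrite expr2 -mulrA bd; nra.
  rewrite /weight invf_ge1 ?sqrtr_gt0 ?subr_gt0//.
  by rewrite -[leRHS]sqrtr1 ler_sqrt// gerBl sqnorm_ge0.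
rewrite -lte_fin /weight_mass fineK.
  apply: (lt_le_trans lB).
  rewrite -(setIT B) -integral_indic//; apply: ge0_le_integral => //.
  - by apply/measurable_EFinP; exact: measurable_indic.
  - by apply/measurable_EFinP; exact: measurable_weight.
  - move=> x _; rewrite lee_fin indicE; have [|_] := boolP (x \in B); last exact: weight_ge0.
    by rewrite inE => /W1.
rewrite ge0_fin_numE ?integral_weight_lty//.
by apply: integral_ge0 => x _; rewrite lee_fin weight_ge0.
Qed.

Lemma weight_massE : (weight_mass%:E = \int[lebT]_x (W x)%:E)%E.
Proof.
rewrite fineK// ge0_fin_numE ?integral_weight_lty//.
by apply: integral_ge0 => x _; rewrite lee_fin weight_ge0.
Qed.

Definition equilibrium_density x := weight_mass^-1 * W x.

Lemma equilibrium_densityE (A : set (d.-tuple R)) : measurable A ->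
  (mu A = \int[lebT]_(x in A) (equilibrium_density x)%:E)%E.
Proof.
move=> mA; rewrite /equilibrium /= /mnormalize.
have M0 := weight_mass_gt0.
have E : ball_weight_measure d setT = weight_mass%:E.
  by rewrite ball_weight_measureE// weight_massE.
rewrite E eqe (gt_eqF M0)/= ball_weight_measureE//.
under [RHS]eq_integral do rewrite EFinM.
rewrite ge0_integralZl//; last 3 first.
- by apply/measurable_EFinP; apply: measurable_funTS; exact: measurable_weight.
- by move=> x _; rewrite lee_fin weight_ge0.
- by rewrite lee_fin invr_ge0 ltW.
by rewrite muleC.
Qed.

Lemma equilibrium_density_ge0 x : 0 <= equilibrium_density x.
Proof. by rewrite mulr_ge0 ?weight_ge0// invr_ge0 ltW// weight_mass_gt0. Qed.

Lemma measurable_equilibrium_density : measurable_fun setT equilibrium_density.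
Proof. by apply: measurable_funM => //; exact: measurable_weight. Qed.

Lemma equilibrium_density_outside x : ~ unit_ball x -> equilibrium_density x = 0.
Proof. by move=> /weight_outside; rewrite /equilibrium_density => ->; rewrite mulr0. Qed.

Lemma ball_density_ge0 x : 0 <= ball_poly x * equilibrium_density x.
Proof.
have [xB|/equilibrium_density_outside ->] := pselect (unit_ball x); last by rewrite mulr0.
by rewrite mulr_ge0// equilibrium_density_ge0.
Qed.

Lemma measurable_ball_density :
  measurable_fun setT (fun x => ball_poly x * equilibrium_density x).
Proof.
by apply: measurable_funM; [exact: measurable_ball_poly|exact: measurable_equilibrium_density].
Qed.

Lemma ball_poly_equilibriumE (A : set (d.-tuple R)) : measurable A ->
  (gmu A = \int[lebT]_(x in A) (ball_poly x * equilibrium_density x)%:E)%E.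
Proof.
move=> mA; rewrite /ball_poly_equilibrium /= /mdensity.
have mAB : measurable (A `&` @unit_ball R d).
  by apply: measurableI => //; exact: measurable_unit_ball.
rewrite integral_mkcond.
rewrite (ge0_integral_density measurable_equilibrium_density
  equilibrium_density_ge0 equilibrium_densityE); last 2 first.
- apply/(measurable_restrictT _ mAB); apply: measurable_funTS.
  by apply/measurable_EFinP; exact: measurable_ball_poly.
- by move=> x; apply: erestrict_ge0 => {}x [_ xB]; rewrite lee_fin.
rewrite [RHS]integral_mkcond; apply: eq_integral => x _; rewrite !patchE in_setI.
case: (x \in A) => /=; last by rewrite mul0e.
have [xB|xB] := pselect (unit_ball x); first by rewrite mem_set// EFinM.
by rewrite memNset// mul0e equilibrium_density_outside// mulr0.
Qed.

Lemma pevalX (m : multinom d) x : peval (mpolyX R m) x = prod_poly (fun i => 'X^(m i)) x.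
Proof. by rewrite /peval mevalX; apply: eq_bigr => i _; rewrite hornerXn. Qed.

Lemma measurable_peval p : measurable_fun setT (peval p).
Proof.
elim/mpolyind: p => [|c m p _ _ mp].
  by rewrite (_ : peval 0 = cst 0)//; apply/funext => x; exact: meval0.
rewrite (_ : peval _ = (fun x => c * peval (mpolyX R m) x + peval p x)); last first.
  by apply/funext => x; rewrite /peval mevalD mevalZ.
apply: measurable_funD => //; apply: measurable_funM => //.
rewrite (_ : peval _ = prod_poly (fun i => 'X^(m i))); last exact/funext/pevalX.
exact: measurable_prod_poly.
Qed.

Lemma integrable_peval_density p :
  lebT.-integrable setT (fun x => (peval p x * equilibrium_density x)%:E).
Proof.
elim/mpolyind: p => [|c m p _ _ ip].
  rewrite (_ : (fun _ => _) = cst 0%E); first exact: integrable0.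
  by apply/funext => x; rewrite /peval meval0 mul0r.
rewrite (_ : (fun x => _) = (fun x =>
    (c * weight_mass^-1)%:E * (W x * prod_poly (fun i => 'X^(m i)) x)%:E +
    (peval p x * equilibrium_density x)%:E)%E); last first.
  apply/funext => x; rewrite -EFinM -EFinD -pevalX /equilibrium_density.
  by rewrite /peval mevalD mevalZ; congr (_%:E); ring.
apply: integrableD => //; apply: integrableZl => //.
exact: integrable_weight_poly.
Qed.

Lemma integrable_peval p : mu.-integrable setT (EFin \o peval p).
Proof.
apply: (integrable_density measurable_equilibrium_density equilibrium_density_ge0
  equilibrium_densityE); first exact: measurable_peval.
exact: integrable_peval_density.
Qed.

Definition ball_integral (p : mpoly d R) : R := \int[mu]_x peval p x.

Lemma ball_integralE p :
  ((ball_integral p)%:E = \int[lebT]_x (peval p x * equilibrium_density x)%:E)%E.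
Proof.
rewrite -(integral_density measurable_equilibrium_density equilibrium_density_ge0
  equilibrium_densityE (measurable_peval p)).
rewrite /ball_integral /Rintegral fineK//; apply: integrable_fin_num => //.
exact: integrable_peval.
Qed.

Lemma poly_inner_ball p q : poly_inner gmu p q = ball_integral (G * (p * q)).
Proof.
have mpq : measurable_fun setT (fun x => peval p x * peval q x).
  by apply: measurable_funM; exact: measurable_peval.
rewrite /poly_inner /Rintegral.
rewrite (integral_density measurable_ball_density ball_density_ge0
  ball_poly_equilibriumE mpq).
transitivity (fine (ball_integral (G * (p * q)))%:E) => //.
rewrite ball_integralE; congr fine.
apply: eq_integral => x _; rewrite mulrA; congr (_ * _)%:E.
by rewrite /peval !mevalM -/(peval G x) peval_ball mulrC.
Qed.

Lemma ball_integral_linear a p q :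
  ball_integral (a *: p + q) = a * ball_integral p + ball_integral q.
Proof.
rewrite /ball_integral -RintegralZl//; last exact: integrable_peval.
have pevalZ x : peval (a *: p) x = a * peval p x by exact: mevalZ.
rewrite -RintegralD//; last 2 first.
- rewrite (_ : EFin \o _ = EFin \o peval (a *: p)); first exact: integrable_peval.
  by apply/funext => x /=; rewrite pevalZ.
- exact: integrable_peval.
by apply: eq_Rintegral => x _; rewrite /peval mevalD mevalZ.
Qed.

(** Both sides are linear in q, so that it suffices to consider monomials, which are
    products of univariate polynomials. *)
Lemma ball_integral_by_parts i q :
  ball_integral (G * mderiv i q) = ball_integral (mpolyX R (mnm1 i) * q).
Proof.
elim/mpolyind: q => [|c m q _ _ IHq]; first by rewrite mderiv0 !mulr0.
rewrite mderivD mderivZ !mulrDr -!scalerAr !ball_integral_linear IHq.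
congr (_ * _ + _); apply/eqP; rewrite -subr_eq0 -eqe EFinB !ball_integralE.
rewrite -integralB//; [|exact: integrable_peval_density..].
apply/eqP; rewrite -[RHS](weight_by_parts weight_mass^-1 1 (fun j => 'X^(m j)) i).
apply: eq_integral => x _; rewrite -EFinB; congr (_%:E).
have -> : peval (G * mderiv i (mpolyX R m)) x =
    (1 - sqnorm x) * prod_poly (subst_factor (fun j => 'X^(m j)) i ('X^(m i))^`()) x.
  rewrite /peval mevalM -/(peval G x) peval_ball ball_polyE; congr (_ * _).
  rewrite mderivX mevalZ mevalX /prod_poly [RHS](bigD1 i)//= [in LHS](bigD1 i)//=.
  rewrite {1}/subst_factor eqxx derivXn hornerMn hornerXn mnmBE mnm1E eqxx subn1.
  rewrite mulrA mulr_natl; congr (_ * _); apply: eq_bigr => j ji.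
  by rewrite /subst_factor (negPf ji) hornerXn mnmBE mnm1E eq_sym (negPf ji) subn0.
have -> : peval (mpolyX R (mnm1 i) * mpolyX R m) x =
    prod_poly (subst_factor (fun j => 'X^(m j)) i ('X * 'X^(m i))) x.
  rewrite /peval mevalM mevalXU mevalX /prod_poly (bigD1 i)//= [RHS](bigD1 i)//=.
  rewrite {1}/subst_factor eqxx hornerM hornerX hornerXn mulrA; congr (_ * _).
  by apply: eq_bigr => j ji; rewrite /subst_factor (negPf ji) hornerXn.
rewrite sqrt_divsqrt /equilibrium_density /weight; ring.
Qed.

Lemma ball_functional_integral : ball_functional ball_integral.
Proof.
split.
- exact: ball_integral_linear.
- rewrite /ball_integral (_ : peval 1 = cst 1); last by apply/funext => x; exact: meval1.
  rewrite Rintegral_cst// mul1r.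
  exact: (congr1 fine (@probability_setT _ _ _ (equilibrium d))).
- by move=> p; apply: Rintegral_ge0 => x _; rewrite /peval mevalM -expr2 sqr_ge0.
- move=> p; rewrite -poly_inner_ball; apply: Rintegral_ge0 => x _.
  by rewrite -expr2 sqr_ge0.
- exact: ball_integral_by_parts.
Qed.

End link.

(** * The two identities *)

Lemma binz1 d m : binz (d.+1%:Z + m%:Z - 1) d = 'C(d + m, d).
Proof. by rewrite -PoszD addSn -addn1 PoszD addrK. Qed.

Lemma binz2S d m : binz (d.+1%:Z + m.+1%:Z - 2) d = 'C(d + m, d).
Proof.
by rewrite -PoszD addSn addnS -addn2 PoszD addrK.
Qed.

Lemma binz20 d : binz (d.+1%:Z + 0%:Z - 2) d = 0%N.
Proof.
case: d => [//|d]; rewrite -PoszD addn0 -addn2 PoszD addrK /=.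
by rewrite bin_small.
Qed.

Lemma binz_sum d n :
  (\sum_(m < n.+1)
     (binz (d.+1%:Z + m%:Z - 1) d + binz (d.+1%:Z + m%:Z - 2) d) =
   binz (d.+1%:Z + n%:Z) d.+1 + binz (d.+1%:Z + n%:Z - 1) d.+1)%N.
Proof.
have E k : binz (d.+1%:Z + k%:Z) d.+1 = 'C(d.+1 + k, d.+1) by [].
have E' k : binz (d.+1%:Z + k%:Z - 1) d.+1 = 'C(d + k, d.+1).
  by rewrite -PoszD addSn -addn1 PoszD addrK.
elim: n => [|n IHn].
  rewrite big_ord1 (_ : nat_of_ord ord0 = 0%N)// E E' binz1 binz20.
  by rewrite !addn0 !binn bin_small.
rewrite big_ord_recr (_ : nat_of_ord ord_max = n.+1)// IHn !E !E' binz1 binz2S.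
by apply: etrans (addnACA _ _ _ _) _; rewrite !addnS addSn -!binS.
Qed.

Section assembly.
Variables (R : realType) (d : nat).
Local Notation mu := (equilibrium d : {measure set (d.-tuple R) -> \bar R}).
Local Notation gmu := (ball_poly_equilibrium d : {measure set (d.-tuple R) -> \bar R}).
Local Notation G := (ball_mpoly R d).
Local Notation msize := (mmeasure (@mdeg d)).

Local Notation L := (@ball_integral R d).
Local Notation LP := (@ball_functional_integral R d).

Lemma muE (p q : mpoly d R) : poly_inner mu p q = L (p * q).
Proof.
rewrite /ball_integral /poly_inner; apply: eq_Rintegral => x _.
by rewrite /peval mevalM.
Qed.

Lemma mu_inner : is_inner_product (poly_inner mu).
Proof.
rewrite (_ : poly_inner mu = fun p q => L (p * q)); first exact: (inner_product_ball LP).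
by apply/funext => p; apply/funext => q; exact: muE.
Qed.

Lemma gmu_inner : is_inner_product (poly_inner gmu).
Proof.
rewrite (_ : poly_inner gmu = fun p q => L (G * (p * q))).
  exact: (inner_product_ball_density LP).
by apply/funext => p; apply/funext => q; exact: poly_inner_ball.
Qed.

Lemma msize_ball_mpoly : (msize G <= 3)%N.
Proof.
apply: leq_trans (mmeasureD_le _ _ _) _; rewrite geq_max mmeasure1 mmeasureN.
apply: leq_trans (mmeasure_sum _ _ _ _) _; apply/bigmax_leqP => i _.
by rewrite mpolyXn mmeasureX/= mdegMn mdeg1.
Qed.

Lemma msize_coderiv i m (h : mpoly d R) : (msize h <= m)%N -> (msize (coderiv i h) <= m.+1)%N.
Proof.
case: m => [|m] hm.
  have -> : h = 0 by apply/eqP; rewrite -(msize_poly_eq0 h) -leqn0.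
  by rewrite /coderiv mderiv0 !mulr0 subr0 mmeasure0.
apply: leq_trans (mmeasureD_le _ _ _) _; rewrite geq_max mmeasureN.
apply/andP; split; first exact: (msize_mul_le msize_ball_mpoly (msize_mderiv i hm)).
by apply: (msize_mul_le (k := 1)) => //; rewrite mmeasureX/= mdeg1.
Qed.

(** By [mderiv_adjoint], as [coderiv] raises the degree by at most one. *)
Lemma mderiv_orth_space i m f : orth_space mu m.+1 f ->
  orth_space gmu m (mderiv i f).
Proof.
move=> fV; apply: (orth_spaceP gmu_inner) => [|q qm].
  by apply: msize_mderiv; exact: orth_space_size fV.
rewrite poly_inner_ball (mderiv_adjoint LP); case: fV => _ fV; rewrite -muE fV ?oppr0//.
exact: msize_coderiv.
Qed.

(** By [mderiv_adjoint], as [mderiv] lowers the degree. *)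
Lemma coderiv_orth_space i m h : orth_space gmu m h ->
  orth_space mu m.+1 (coderiv i h).
Proof.
move=> hV; apply: (orth_spaceP mu_inner) => [|q qm].
  by apply: msize_coderiv; exact: orth_space_size hV.
rewrite muE mulrC -[LHS]opprK -(mderiv_adjoint LP) [mderiv i q * h]mulrC -poly_inner_ball.
by case: hV => _ ->; rewrite ?oppr0//; exact: msize_mderiv.
Qed.

(** A constant polynomial is equal to its image by L, and each square
    contributes 1. *)
Lemma sum_sqr_const (I J : finType) (PI : pred I) (PJ : pred J)
    (e : I -> mpoly d R) (u : J -> mpoly d R) x :
  (forall i, mderiv i
     (\sum_(a | PI a) e a * e a + G * \sum_(b | PJ b) u b * u b) = 0) ->
  (forall a, PI a -> L (e a * e a) = 1) ->
  (forall b, PJ b -> L (G * (u b * u b)) = 1) ->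
  \sum_(a | PI a) peval (e a) x * peval (e a) x +
    ball_poly x * \sum_(b | PJ b) peval (u b) x * peval (u b) x =
  (#|PI| + #|PJ|)%:R.
Proof.
move=> /mderiv_eq0; set c := mcoeff _ _; set K := _ + _ => Kc e1 u1.
transitivity (peval K x).
  rewrite /K /peval mevalD mevalM -/(peval G x) peval_ball.
  rewrite [X in _ = X + _]raddf_sum [X in _ = _ + _ * X]raddf_sum/=.
  congr (_ + _ * _); apply: eq_bigr => a _; rewrite mevalM//.
have -> : peval K x = L K.
  by rewrite Kc /peval mevalC -[mpolyC d c]mulr1 mul_mpolyC (bfZ LP) (bf_1 LP) mulr1.
rewrite /K (bfD LP) mulr_sumr !(bf_sum LP) natrD -!sumr_const.
by congr (_ + _); apply: eq_bigr => a Pa; rewrite ?e1 ?u1.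
Qed.

Lemma kernel_identity m x (hd : (0 < d)%N) :
  rkernel mu m%:Z x x + ball_poly x * rkernel gmu (m%:Z - 1) x x =
  (binz (d%:Z + m%:Z - 1) (d - 1) + binz (d%:Z + m%:Z - 2) (d - 1))%:R.
Proof.
have e1 k (a : bmultinom d k.+1) : mdeg a == k ->
    L (orth_basis mu k a * orth_basis mu k a) = 1.
  move=> /eqP ak; have [_ h _] := orth_basisP mu_inner k.
  by rewrite -muE h// eqxx.
have u1 k (a : bmultinom d k.+1) : mdeg a == k ->
    L (G * (orth_basis gmu k a * orth_basis gmu k a)) = 1.
  move=> /eqP ak; have [_ h _] := orth_basisP gmu_inner k.
  by rewrite -poly_inner_ball h// eqxx.
have [d' dE] : exists d', d = d'.+1 by exists d.-1; rewrite prednK.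
have binz1' k : binz (d%:Z + k%:Z - 1) (d - 1) = 'C(d' + k, d').
  by rewrite dE subn1 binz1.
have card k : #|[pred b : bmultinom d k.+1 | mdeg b == k]| = 'C(d' + k, d').
  by rewrite dE card_layer.
case: m => [|m].
  (* in degree 0 the kernel of index -1 is an empty sum *)
  have -> : rkernel gmu (0%:Z - 1) x x = \sum_(b : bmultinom d 1 | pred0 b)
      peval (0 : mpoly d R) x * peval 0 x by rewrite big_pred0.
  rewrite rkernelE (sum_sqr_const (e := fun a : bmultinom d 1 => orth_basis mu 0 a)
    (u := fun=> 0))//; first last.
  - exact: e1.
  - move=> i; apply: (mderiv_kernel_eq0 LP) => // a /eqP a0; rewrite big_pred0//.
    apply/eqP; rewrite -(msize_poly_eq0 (mderiv i _)) -leqn0; apply: msize_mderiv.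
    have [h _ _] := orth_basisP mu_inner 0; exact: orth_space_size (h _ a0).
  by rewrite card binz1' card0 dE subn1 binz20.
have -> : m.+1%:Z - 1 = m%:Z by rewrite -addn1 PoszD addrK.
rewrite !rkernelE.
rewrite (sum_sqr_const (e := fun a : bmultinom d m.+2 => orth_basis mu m.+1 a)
  (u := fun a : bmultinom d m.+1 => orth_basis gmu m a))//; first last.
- exact: u1.
- exact: e1.
- move=> i; apply: (mderiv_kernel_eq0 LP) => //.
  + move=> a /eqP am; under eq_bigr do rewrite -poly_inner_ball.
    apply: (orthonormal_basis_expand gmu_inner (orth_basisP gmu_inner m)).
    apply: mderiv_orth_space; have [h _ _] := orth_basisP mu_inner m.+1; exact: h.
  + move=> b /eqP bm; under eq_bigr do rewrite -muE.
    apply: (orthonormal_basis_expand mu_inner (orth_basisP mu_inner m.+1)).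
    apply: coderiv_orth_space; have [h _ _] := orth_basisP gmu_inner m; exact: h.
by rewrite !card binz1' dE subn1 binz2S.
Qed.

Lemma christoffel_identity n x (hd : (0 < d)%N) :
  inv_christoffel mu n%:Z x + ball_poly x * inv_christoffel gmu (n%:Z - 1) x =
  (binz (d%:Z + n%:Z) d + binz (d%:Z + n%:Z - 1) d)%:R.
Proof.
have [d' dE] : exists d', d = d'.+1 by exists d.-1; rewrite prednK.
have -> : inv_christoffel gmu (n%:Z - 1) x = \sum_(m < n.+1) rkernel gmu (m%:Z - 1) x x.
  rewrite big_ord_recl add0r; case: n => [|n]; first by rewrite big_ord0.
  have E k : k.+1%:Z - 1 = k%:Z by rewrite -addn1 PoszD addrK.
  by rewrite E (inv_christoffelE gmu_inner); apply: eq_bigr => i _; rewrite E.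
rewrite (inv_christoffelE mu_inner) mulr_sumr -big_split/=.
under eq_bigr do rewrite kernel_identity//.
by rewrite -natr_sum; congr (_%:R); rewrite dE subn1 binz_sum.
Qed.

End assembly.

Theorem theorem4p1 (R : realType) (d : nat) (hd : (1 <= d)%N) :
  (forall (m : nat) (x : d.-tuple R),
     rkernel (equilibrium d) m%:Z x x
       + ball_poly x * rkernel (ball_poly_equilibrium d) (m%:Z - 1) x x
     = (binz (d%:Z + m%:Z - 1) (d - 1) + binz (d%:Z + m%:Z - 2) (d - 1))%:R)
  /\
  (forall (n : nat) (x : d.-tuple R),
     inv_christoffel (equilibrium d) n%:Z x
       + ball_poly x * inv_christoffel (ball_poly_equilibrium d) (n%:Z - 1) x
     = (binz (d%:Z + n%:Z) d + binz (d%:Z + n%:Z - 1) d)%:R).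
Proof.
split=> [m x|n x]; first exact: kernel_identity.
exact: christoffel_identity.
Qed.
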